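(* Let $0<p<1$ and $0<\varepsilon<1$, and let $\{(n_m,\lambda,\rho)\}_{m\in\mathbb{N}}$ be a sequence of LDPC ensembles with block lengths $n_m\to\infty$, transmitted over a binary erasure channel (BEC) with erasure probability $p$. Assume that this sequence achieves a fraction $1-\varepsilon$ of the channel capacity under message-passing decoding. Let $L_2=L_2(\varepsilon)$ be the fraction of variable nodes of degree $2$. In the asymptotic case where the block length tends to infinity, let $l=l(\varepsilon,p,P_{\mathrm b})$ denote the number of iterations required to achieve an average bit erasure probability $P_{\mathrm b}\ge 0$ over the ensemble. If $P_{\mathrm b}<p\,L_2(\varepsilon)$, then $$l(\varepsilon,p,P_{\mathrm b})\;\ge\;\frac{2}{1-p}\Bigl(\sqrt{p\,L_2(\varepsilon)}-\sqrt{P_{\mathrm b}}\Bigr)^2\,\frac1\varepsilon .$$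
   Context: Degree distributions. An LDPC ensemble $(n,\lambda,\rho)$ has edge-perspective degree distributions $\lambda(x)=\sum_{i\ge2}\lambda_i x^{i-1}$ (variable nodes) and $\rho(x)=\sum_{i\ge1}\rho_i x^{i-1}$ (parity-check nodes), with non-negative coefficients and $\lambda(1)=\rho(1)=1$; $\lambda_i$ (resp. $\rho_i$) is the fraction of edges attached to variable (resp. check) nodes of degree $i$. The node-perspective left degree distribution is $L(x)=\sum_{i\ge2}L_ix^i=\int_0^x\lambda(t)\,dt\big/\int_0^1\lambda(t)\,dt$, so $L_i$ is the fraction of variable nodes of degree $i$. The average left degree is $a_{\mathrm L}=L'(1)=1/\int_0^1\lambda(t)\,dt$ and the design rate is $R=1-\int_0^1\rho(t)\,dt\big/\int_0^1\lambda(t)\,dt$. Asymptotic analysis (density evolution, flooding schedule). In the limit of infinite block length, the expected fraction of erasures in variable-to-check messages at iteration $l=0,1,2,\dots$ is $x^{(l)}$, where $x^{(0)}=p$ and $x^{(l+1)}=p\,\lambda\bigl(1-\rho(1-x^{(l)})\bigr)$. The average bit erasure probability after iteration $l$ is $P_{\mathrm b}^{(l)}=p\,L\bigl(1-\rho(1-x^{(l)})\bigr)$. Achieving a fraction of capacity. The capacity of the BEC is $C=1-p$. The sequence achieves a fraction $1-\varepsilon$ of the channel capacity under message-passing decoding if its (design) rate satisfies $R\ge(1-\varepsilon)C$ and the achievable bit erasure probability vanishes, i.e. $P_{\mathrm b}^{(l)}\to0$ as $l\to\infty$. Number of iterations. Since iterations are counted starting from $0$, $l(\varepsilon,p,P_{\mathrm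 b})$ is the smallest integer $l\ge1$ with $P_{\mathrm b}^{(l-1)}\le P_{\mathrm b}$ (it is $\infty$ if there is none). *)

(* Defs.v *)
From Stdlib Require Export Reals.
From Coquelicot Require Export Coquelicot.
From Stdlib Require Import Lra Lia Classical.
Open Scope R_scope.

(** Edge-perspective distributions are given by their coefficients: [a i] is
    the fraction of edges attached to nodes of degree [i].  Infinite support is
    allowed; [d] is the smallest admissible degree. *)
Definition edge_distribution (d : nat) (a : nat -> R) : Prop :=
  (forall i, 0 <= a i) /\ (forall i, (i < d)%nat -> a i = 0) /\ is_series a 1.

(** [a 1 + a 2 x + a 3 x^2 + ...] *)
Definition edge_gf (a : nat -> R) (x : R) : R := PSeries (fun k => a (S k)) x.

Definition node_gf (lam : nat -> R) (x : R) : R :=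
  RInt (edge_gf lam) 0 x / RInt (edge_gf lam) 0 1.

(** Coefficient of [x^i] in [node_gf lam], see [node_gf_coef] below. *)
Definition node_fraction (lam : nat -> R) (i : nat) : R :=
  lam i / INR i / RInt (edge_gf lam) 0 1.

Definition design_rate (lam rho : nat -> R) : R :=
  1 - RInt (edge_gf rho) 0 1 / RInt (edge_gf lam) 0 1.

(** Density evolution on the BEC with erasure probability [p], in the limit of
    infinite block length. *)
Fixpoint message_erasure (lam rho : nat -> R) (p : R) (l : nat) : R :=
  match l with
  | O => p
  | S l' => p * edge_gf lam (1 - edge_gf rho (1 - message_erasure lam rho p l'))
  end.

Definition bit_erasure (lam rho : nat -> R) (p : R) (l : nat) : R :=
  p * node_gf lam (1 - edge_gf rho (1 - message_erasure lam rho p l)).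

Definition achieves_capacity_fraction (lam rho : nat -> R) (p r : R) : Prop :=
  r * (1 - p) <= design_rate lam rho /\ is_lim_seq (bit_erasure lam rho p) 0.

(** The least natural number satisfying [P], or [p_infty] if there is none. *)
Definition least_nat (P : nat -> Prop) : Rbar :=
  match LPO_min P (fun n => classic (P n)) with
  | inleft n => Finite (INR (proj1_sig n))
  | inright _ => p_infty
  end.

(** Iterations are indexed from [0], so [l] of them end with index [l - 1]. *)
Definition num_iterations (lam rho : nat -> R) (p Pb : R) : Rbar :=
  least_nat (fun l => (1 <= l)%nat /\ bit_erasure lam rho p (l - 1) <= Pb).

Local Definition clamp (t : R) : R := Rmax 0 (Rmin 1 t).

Local Lemma clamp_bound t : 0 <= clamp t <= 1.
Proof. unfold clamp, Rmax, Rmin; repeat destruct Rle_dec; lra. Qed.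

Local Lemma clamp_id t : 0 <= t <= 1 -> clamp t = t.
Proof. unfold clamp, Rmax, Rmin; repeat destruct Rle_dec; lra. Qed.

Local Lemma pow_unit t n : 0 <= t <= 1 -> 0 <= t ^ n <= 1.
Proof.
  intros Ht; split; [now apply pow_le|].
  rewrite <- (pow1 n); apply pow_incr; lra.
Qed.

Local Lemma edge_gf_partial_sum a N t :
  (forall i, 0 <= a i) -> ex_series a -> 0 <= t <= 1 ->
  Rabs (sum_f_R0 (fun k => a (S k) * t ^ k) N - edge_gf a t)
  <= Series a - sum_f_R0 a (S N).
Proof.
  intros Ha Hs Ht.
  assert (Hle : forall k, 0 <= a (S k) * t ^ k <= a (S k)).
  { intros k; pose proof (pow_unit t k Ht); pose proof (Ha (S k)); nra. }
  assert (Hs1 : ex_series (fun k => a (S k))).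
  { now apply (ex_series_incr_1 a). }
  assert (Hs2 : ex_series (fun k => a (S k) * t ^ k)).
  { apply (ex_series_le (K := R_AbsRing) (V := R_CompleteNormedModule) _
      (fun k => a (S k))); [|exact Hs1].
    intros k; change (Rabs (a (S k) * t ^ k) <= a (S k)).
    rewrite Rabs_pos_eq; apply Hle. }
  unfold edge_gf, PSeries.
  rewrite (Series_incr_n _ (S N)); [|lia|exact Hs2].
  rewrite (Series_incr_n a (S (S N))); [|lia|exact Hs].
  cbn [Init.Nat.pred].
  assert (H0 : Series (fun k => a (S (S N + k)) * t ^ (S N + k))
               <= Series (fun k => a (S (S N) + k)%nat)).
  { apply Series_le; [intros n; apply (Hle (S N + n)%nat)|].
    exact (proj1 (ex_series_incr_n a (S (S N))) Hs). }
  assert (H1 : 0 <= Series (fun k => a (S (S N + k)) * t ^ (S N + k))).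
  { rewrite <- (Rmult_0_l (Series a)), <- Series_scal_l.
    apply Series_le; [intros n; rewrite Rmult_0_l; split;
      [lra|apply (Hle (S N + n)%nat)]|].
    exact (proj1 (ex_series_incr_n (fun k => a (S k) * t ^ k) (S N)) Hs2). }
  apply Rabs_le; lra.
Qed.

Local Lemma is_RInt_poly (a : nat -> R) N x :
  is_RInt (fun t => sum_f_R0 (fun k => a (S k) * t ^ k) N) 0 x
    (sum_f_R0 (fun k => a (S k) / INR (S k) * x ^ S k) N).
Proof.
  assert (Hk : forall k, is_RInt (fun t => a (S k) * t ^ k) 0 x
                 (a (S k) / INR (S k) * x ^ S k)).
  { intros k.
    replace (a (S k) / INR (S k) * x ^ S k)
      with (a (S k) * (x ^ S k / INR (S k) - 0 ^ S k / INR (S k))).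
    2: { rewrite pow_i by lia. field. apply not_0_INR; lia. }
    apply (is_RInt_scal (V := R_NormedModule)), is_RInt_pow. }
  induction N as [|N IH]; [apply (Hk 0%nat)|].
  cbn [sum_f_R0]; now apply (is_RInt_plus (V := R_NormedModule)).
Qed.

Lemma is_RInt_edge_gf a x :
  (forall i, 0 <= a i) -> ex_series a -> 0 <= x <= 1 ->
  ex_RInt (edge_gf a) 0 x /\
  is_series (fun k => a (S k) / INR (S k) * x ^ S k) (RInt (edge_gf a) 0 x).
Proof.
  intros Ha Hs Hx.
  destruct (filterlim_RInt (V := R_CompleteNormedModule)
    (fun N t => sum_f_R0 (fun k => a (S k) * clamp t ^ k) N)
    0 x eventually eventually_filter (fun t => edge_gf a (clamp t))
    (fun N => sum_f_R0 (fun k => a (S k) / INR (S k) * x ^ S k) N))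
    as [If [Hlim HIf]].
  - intros N; apply (is_RInt_ext (fun t => sum_f_R0 (fun k => a (S k) * t ^ k) N));
      [|apply is_RInt_poly].
    intros t Ht; rewrite Rmin_left, Rmax_right in Ht by lra.
    now rewrite clamp_id by lra.
  - apply filterlim_locally; intros e.
    destruct Hs as [s Hs].
    assert (He := proj1 (filterlim_locally _ _) Hs e).
    destruct He as [N0 HN0]; exists N0; intros N HN t.
    assert (Hb := HN0 (S N) (le_S _ _ HN)).
    rewrite sum_n_Reals in Hb.
    change (Rabs (sum_f_R0 a (S N) - s) < e) in Hb.
    change (Rabs (sum_f_R0 (fun k => a (S k) * clamp t ^ k) N -
      edge_gf a (clamp t)) < e).
    eapply Rle_lt_trans; [apply edge_gf_partial_sum; auto using clamp_bound;
      now exists s|].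
    rewrite (is_series_unique _ _ Hs).
    eapply Rle_lt_trans; [apply Rle_abs|]; now rewrite Rabs_minus_sym.
  - assert (HI : is_RInt (edge_gf a) 0 x If).
    { refine (is_RInt_ext _ _ _ _ _ _ HIf).
      intros t Ht; rewrite Rmin_left, Rmax_right in Ht by lra.
      now rewrite clamp_id by lra. }
    split; [now exists If|].
    rewrite (is_RInt_unique _ _ _ _ HI).
    refine (filterlim_ext _ _ _ Hlim).
    intros N; now rewrite sum_n_Reals.
Qed.

Lemma node_gf_coef lam x :
  edge_distribution 2 lam -> 0 <= x <= 1 ->
  is_series (fun i => node_fraction lam i * x ^ i) (node_gf lam x).
Proof.
  intros [Hp [H2 Hs]] Hx.
  destruct (is_RInt_edge_gf lam x Hp (ex_intro _ 1 Hs) Hx) as [_ H].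
  apply is_series_decr_1.
  unfold node_fraction at 2; rewrite (H2 0%nat) by lia.
  unfold node_gf, Rdiv.
  replace (plus _ _) with (scal (/ RInt (edge_gf lam) 0 1) (RInt (edge_gf lam) 0 x)).
  2: { unfold plus, opp, scal; simpl; unfold mult; simpl; ring. }
  refine (is_series_ext _ _ _ _ (is_series_scal _ _ _ H)).
  intros n; unfold node_fraction, Rdiv, scal; simpl; unfold mult; simpl; ring.
Qed.

(* Main.v *)
Require Import Defs.
From Stdlib Require Import Reals.
From Coquelicot Require Import Coquelicot.
From Stdlib Require Import Lra Psatz Lia.
Open Scope R_scope.

(** Write [x_l] for the message erasure probabilities, [y_0 = 1],
    [y_(l+1) = 1 - rho (1 - x_l)], so that [x_l = p lam(y_l)], and let
    [d_l = y_l - y_(l+1)], [q = p lam_2].  Density evolution is a staircase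
    between the curves [x = p lam(y)] and [y = 1 - rho (1 - x)], which enclose
    the area [G = int rho - p int lam <= eps (1 - p) int lam].  The part of this
    area at heights between [y_(l+1)] and [y_l] is at least [q d_l ^ 2]: to the
    left of [x_l] because [p lam] has slope at least [q], and to the right of
    [x_l] because the concave check curve has slope at most [1 / q].
    Cauchy-Schwarz then gives [q (1 - y_m) ^ 2 <= m G], and the bit erasure
    probability after iteration [m - 1] is at least [p L_2 y_m ^ 2].

    If [rho_1 > 0] the check curve ends below height [1], the first strip is cut
    off at [x = 1], and its area may fall short of [q d_0 ^ 2].  The deficit is
    bounded using the positivity of the rate and the stability condition
    [q rho'(1) <= 1], and is compensated by the area below [y_m] and by the
    variance of the steps [d_l] neglected in Cauchy-Schwarz. *)

(** * Generating functions of degree distributions *)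

(** The exempted term may be negative: [edge_gf_le_quadratic] isolates [a 2 * (x ^ 2 - x)], which is
    at most 0 on the unit interval. *)
Lemma is_series_ge_term (f : nat -> R) (l : R) (j : nat) :
  is_series f l -> (forall k, k <> j -> 0 <= f k) -> f j <= l.
Proof.
  intros Hf Hpos.
  apply (is_lim_seq_le_loc (fun _ => f j) (sum_n f) (f j) l);
    [|apply is_lim_seq_const|exact Hf].
  exists j. intros N HN.
  assert (H : forall N, (if Nat.leb j N then f j else 0) <= sum_n f N).
  { induction N0 as [|M IH].
    - rewrite sum_O. destruct (Nat.leb_spec j 0); [replace j with 0%nat by lia; lra|].
      apply Hpos; lia.
    - rewrite sum_Sn. unfold plus; simpl.
      destruct (Nat.eq_dec j (S M)) as [->|Hne].
      + rewrite Nat.leb_refl. destruct (Nat.leb_spec (S M) M); [lia|lra].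
      + specialize (Hpos (S M) ltac:(lia)).
        destruct (Nat.leb_spec j M), (Nat.leb_spec j (S M)); try lia; lra. }
  specialize (H N). destruct (Nat.leb_spec j N); [exact H|lia].
Qed.

Lemma is_series_nonneg (f : nat -> R) (l : R) :
  is_series f l -> (forall k, 0 <= f k) -> 0 <= l.
Proof.
  intros Hf Hpos. apply Rle_trans with (f 0%nat); [apply Hpos|].
  now apply is_series_ge_term; [|intros k _].
Qed.

Lemma sum_n_le_series (f : nat -> R) (l : R) (N : nat) :
  is_series f l -> (forall k, 0 <= f k) -> sum_n f N <= l.
Proof.
  intros Hf Hpos.
  apply (is_lim_seq_le_loc (fun _ => sum_n f N) (sum_n f) (sum_n f N) l);
    [|apply is_lim_seq_const|exact Hf].
  exists N. intros M HM. induction HM as [|M HM IH]; [lra|].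
  rewrite sum_Sn. unfold plus; simpl. specialize (Hpos (S M)). lra.
Qed.

Lemma is_series_shift d a :
  (1 <= d)%nat -> edge_distribution d a -> is_series (fun k => a (S k)) 1.
Proof.
  intros Hd (Ha & H0 & Hs).
  apply is_series_incr_1. refine (eq_ind 1 (is_series a) Hs _ _).
  rewrite (H0 0%nat) by lia. unfold plus; simpl; ring.
Qed.

Lemma is_series_edge_gf d a t :
  (1 <= d)%nat -> edge_distribution d a -> 0 <= t <= 1 ->
  is_series (fun k => a (S k) * t ^ k) (edge_gf a t).
Proof.
  intros Hd Ha Ht. apply Series_correct.
  apply (ex_series_le (K := R_AbsRing) (V := R_CompleteNormedModule) _ (fun k => a (S k)));
    [|exists 1; now apply (is_series_shift d)].
  intros k. change (Rabs (a (S k) * t ^ k) <= a (S k)).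
  destruct Ha as (Ha & _). specialize (Ha (S k)).
  assert (0 <= t ^ k <= 1) by (split; [apply pow_le|rewrite <- (pow1 k); apply pow_incr]; lra).
  rewrite Rabs_pos_eq; nra.
Qed.

(** Reduces a linear inequality between values of a generating function to one between powers, since
    the coefficients are nonnegative. *)
Lemma is_series_edge_gf_comb d a x y z alpha beta gamma :
  (1 <= d)%nat -> edge_distribution d a ->
  0 <= x <= 1 -> 0 <= y <= 1 -> 0 <= z <= 1 ->
  is_series (fun k => a (S k) * (alpha * x ^ k + beta * y ^ k + gamma * z ^ k))
    (alpha * edge_gf a x + beta * edge_gf a y + gamma * edge_gf a z).
Proof.
  intros Hd Ha Hx Hy Hz.
  assert (Sx := is_series_scal_l alpha _ _ (is_series_edge_gf d a x Hd Ha Hx)).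
  assert (Sy := is_series_scal_l beta _ _ (is_series_edge_gf d a y Hd Ha Hy)).
  assert (Sz := is_series_scal_l gamma _ _ (is_series_edge_gf d a z Hd Ha Hz)).
  refine (is_series_ext _ _ _ _ (is_series_plus _ _ _ _ (is_series_plus _ _ _ _ Sx Sy) Sz)).
  intros k. unfold plus, scal; simpl; unfold mult; simpl. ring.
Qed.

Lemma edge_gf_0 a : edge_gf a 0 = a 1%nat.
Proof. unfold edge_gf. now rewrite PSeries_0. Qed.

Lemma edge_gf_1 d a : (1 <= d)%nat -> edge_distribution d a -> edge_gf a 1 = 1.
Proof.
  intros Hd Ha. apply is_series_unique.
  refine (is_series_ext _ _ _ _ (is_series_shift d a Hd Ha)).
  intros k. now rewrite pow1, Rmult_1_r.
Qed.

Lemma edge_gf_increment d a x y :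
  (1 <= d)%nat -> edge_distribution d a -> 0 <= x <= y -> y <= 1 ->
  a 2%nat * (y - x) <= edge_gf a y - edge_gf a x.
Proof.
  intros Hd Ha Hx Hy.
  assert (Hs := is_series_edge_gf_comb d a x y y (-1) 1 0 Hd Ha ltac:(lra) ltac:(lra) ltac:(lra)).
  apply is_series_ge_term with (j := 1%nat) in Hs; [lra|].
  intros k _. apply Rmult_le_pos; [apply Ha|].
  assert (x ^ k <= y ^ k) by (apply pow_incr; lra). lra.
Qed.

Lemma edge_gf_le d a x y :
  (1 <= d)%nat -> edge_distribution d a -> 0 <= x <= y -> y <= 1 ->
  edge_gf a x <= edge_gf a y.
Proof.
  intros Hd Ha Hx Hy. assert (H := edge_gf_increment d a x y Hd Ha Hx Hy).
  assert (0 <= a 2%nat * (y - x)) by (apply Rmult_le_pos; [apply Ha|lra]). lra.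
Qed.

Lemma edge_gf_bound d a x :
  (1 <= d)%nat -> edge_distribution d a -> 0 <= x <= 1 -> 0 <= edge_gf a x <= 1.
Proof.
  intros Hd Ha Hx. split.
  - apply Rle_trans with (edge_gf a 0); [rewrite edge_gf_0; apply Ha|].
    apply (edge_gf_le d); auto; lra.
  - rewrite <- (edge_gf_1 d a Hd Ha). apply (edge_gf_le d); auto; lra.
Qed.

(** Three-chord inequality, multiplied out so that coinciding points are covered. It is proved for
    each power separately. *)
Lemma edge_gf_convex d a x y z :
  (1 <= d)%nat -> edge_distribution d a -> 0 <= x <= y -> y <= z <= 1 ->
  (edge_gf a y - edge_gf a x) * (z - y) <= (edge_gf a z - edge_gf a y) * (y - x).
Proof.
  intros Hd Ha Hx Hy.
  assert (Hs := is_series_edge_gf_comb d a x y z (z - y) (x - z) (y - x)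
    Hd Ha ltac:(lra) ltac:(lra) ltac:(lra)).
  apply is_series_nonneg in Hs; [lra|].
  intros k. apply Rmult_le_pos; [apply Ha|].
  assert (Hk : (y ^ k - x ^ k) * (z - y) <= (z ^ k - y ^ k) * (y - x)); [|lra].
  induction k as [|k IH]; [simpl; lra|].
  assert (0 <= x ^ k) by (apply pow_le; lra).
  assert (x ^ k <= y ^ k) by (apply pow_incr; lra).
  assert (y ^ k <= z ^ k) by (apply pow_incr; lra).
  simpl.
  (* The excess at [S k] is [y] times the excess at [k], plus
     [(z - y) * (y - x) * (z ^ k - x ^ k)]. *)
  assert (0 <= (z - y) * (y - x)) by (apply Rmult_le_pos; lra).
  assert (0 <= ((z ^ k - y ^ k) * (y - x) - (y ^ k - x ^ k) * (z - y)) * y)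
    by (apply Rmult_le_pos; lra).
  assert (0 <= (z - y) * (y - x) * (z ^ k - x ^ k)) by (apply Rmult_le_pos; lra).
  lra.
Qed.

(** On the unit interval every power from the second on is at most [x ^ 2], and these powers carry
    the weight [1 - a 2]. *)
Lemma edge_gf_le_quadratic a x :
  edge_distribution 2 a -> 0 <= x <= 1 ->
  edge_gf a x <= a 2%nat * x + (1 - a 2%nat) * x ^ 2.
Proof.
  intros Ha Hx.
  assert (Hs := is_series_edge_gf_comb 2 a 1 x x (x ^ 2) (-1) 0 ltac:(lia) Ha
    ltac:(lra) Hx Hx).
  rewrite (edge_gf_1 2) in Hs by (auto; lia).
  apply is_series_ge_term with (j := 1%nat) in Hs; [lra|].
  intros k Hk. destruct k as [|[|k]]; [|lia|].
  - destruct Ha as (_ & H0 & _). rewrite (H0 1%nat) by lia. lra.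
  - apply Rmult_le_pos; [apply Ha|]. rewrite pow1.
    assert (0 <= x ^ k <= 1) by (split; [apply pow_le|rewrite <- (pow1 k); apply pow_incr]; lra).
    simpl. assert (0 <= x * x) by nra. nra.
Qed.

Lemma edge_coef_le_1 d a i : edge_distribution d a -> a i <= 1.
Proof. intros (Ha & _ & Hs). apply is_series_ge_term with (1 := Hs); auto. Qed.

Lemma ex_RInt_edge_gf d a x y :
  edge_distribution d a -> 0 <= x <= y -> y <= 1 -> ex_RInt (edge_gf a) x y.
Proof.
  intros (Ha & _ & Hs) Hx Hy.
  apply (ex_RInt_Chasles_2 (V := R_CompleteNormedModule) _ 0); [lra|].
  apply is_RInt_edge_gf; auto; [now exists 1|lra].
Qed.

(** * Moment and integral bounds for a degree distribution *)

Lemma pow_1_minus_le x k : 0 <= x <= 1 -> (1 - x) ^ k <= 1 - INR k * x + INR k ^ 2 * x ^ 2.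
Proof.
  intros Hx. induction k as [|k IH]; [simpl; lra|].
  rewrite S_INR. change ((1 - x) ^ S k) with ((1 - x) * (1 - x) ^ k).
  apply Rle_trans with ((1 - x) * (1 - INR k * x + INR k ^ 2 * x ^ 2)).
  - apply Rmult_le_compat_l; lra.
  - pose proof (pos_INR k).
    assert (0 <= INR k * x ^ 2) by (apply Rmult_le_pos; [lra|apply pow2_ge_0]).
    assert (0 <= INR k ^ 2 * x ^ 2 * x).
    { repeat apply Rmult_le_pos; try lra; apply pow_le; lra. }
    assert (0 <= x ^ 2) by apply pow2_ge_0. lra.
Qed.

Lemma sum_n_linear (f g : nat -> R) b c N :
  sum_n (fun k => b * f k + c * g k) N = b * sum_n f N + c * sum_n g N.
Proof.
  induction N as [|N IH]; [now rewrite !sum_O|].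
  rewrite !sum_Sn, IH. unfold plus; simpl. ring.
Qed.

Lemma sum_n_le (f g : nat -> R) N : (forall k, f k <= g k) -> sum_n f N <= sum_n g N.
Proof.
  intros H. induction N as [|N IH]; [now rewrite !sum_O|].
  rewrite !sum_Sn. unfold plus; simpl. specialize (H (S N)). lra.
Qed.

(** [M] bounds the slopes of chords ending at 1 whose lengths tend to 0, hence the derivative at 1.
    Partial sums avoid presupposing that this derivative is finite. *)
Lemma moment_le d a M (x : nat -> R) N :
  (1 <= d)%nat -> edge_distribution d a ->
  (forall n, 0 < x n <= 1) -> is_lim_seq x 0 ->
  (forall n, 1 - edge_gf a (1 - x n) <= x n * M) ->
  sum_n (fun k => INR k * a (S k)) N <= M.
Proof.
  intros Hd Ha Hx Hlim HM.
  set (Q := sum_n (fun k => INR k ^ 2 * a (S k)) N).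
  set (m := sum_n (fun k => INR k * a (S k)) N).
  (* For fixed [N] the second-order remainder costs at most [Q * x n], which vanishes in the
     limit. *)
  assert (H : forall n, m - Q * x n <= M).
  { intros n. specialize (Hx n). specialize (HM n). set (e := x n) in *. clearbody e.
    apply Rmult_le_reg_l with e; [lra|].
    apply Rle_trans with (2 := HM).
    assert (Hs := is_series_edge_gf_comb d a 1 (1 - e) 1 1 (-1) 0 Hd Ha
      ltac:(lra) ltac:(lra) ltac:(lra)).
    apply sum_n_le_series with (N := N) in Hs.
    - rewrite (edge_gf_1 d) in Hs by auto.
      apply Rle_trans with (2 := Rle_trans _ _ (1 - edge_gf a (1 - e)) Hs ltac:(lra)).
      replace (e * (m - Q * e)) with (e * m + - e ^ 2 * Q) by ring.
      unfold m, Q. rewrite <- sum_n_linear.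
      apply sum_n_le. intros k.
      assert (Hp := pow_1_minus_le e k ltac:(lra)). rewrite pow1.
      assert (0 <= a (S k)) by apply Ha.
      apply Rle_trans with (a (S k) * (INR k * e - INR k ^ 2 * e ^ 2)).
      + right; ring.
      + apply Rmult_le_compat_l; lra.
    - intros k. apply Rmult_le_pos; [apply Ha|]. rewrite pow1.
      assert (Hp := pow_incr (1 - e) 1 k ltac:(lra)). rewrite pow1 in Hp. lra. }
  apply (is_lim_seq_le (fun n => m - Q * x n) (fun _ => M) m M);
    [exact H| |apply is_lim_seq_const].
  replace (Finite m) with (Finite (m - Q * 0)) by (f_equal; ring).
  apply is_lim_seq_minus'; [apply is_lim_seq_const|].
  now apply is_lim_seq_scal_l with (lu := Finite 0).
Qed.

(** The factor [k] is at least 2 except at [k = 0] and [k = 1], where it falls short of 2 by 2 and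
    by 1. *)
Lemma moment_ge d a M :
  (1 <= d)%nat -> edge_distribution d a ->
  (forall N, sum_n (fun k => INR k * a (S k)) N <= M) ->
  2 - 2 * a 1%nat - a 2%nat <= M.
Proof.
  intros Hd Ha HM.
  apply (is_lim_seq_le_loc (fun N => 2 * sum_n (fun k => a (S k)) N - (2 * a 1%nat + a 2%nat))
    (fun _ => M) (2 - 2 * a 1%nat - a 2%nat) M); [|..|apply is_lim_seq_const].
  - exists 1%nat. intros N HN. apply Rle_trans with (2 := HM N).
    induction HN as [|N HN IH].
    + rewrite !sum_Sn, !sum_O. unfold plus; simpl. lra.
    + rewrite !sum_Sn. unfold plus; simpl plus; cbn beta.
      assert (0 <= a (S (S N))) by apply Ha.
      assert (2 <= INR (S N)) by (apply (le_INR 2); lia).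
      assert (0 <= (INR (S N) - 2) * a (S (S N))) by (apply Rmult_le_pos; lra).
      change (2 * (sum_n (fun k => a (S k)) N + a (S (S N))) - (2 * a 1%nat + a 2%nat) <=
        sum_n (fun k => INR k * a (S k)) N + INR (S N) * a (S (S N))). lra.
  - replace (2 - 2 * a 1%nat - a 2%nat) with (2 * 1 - (2 * a 1%nat + a 2%nat)) by ring.
    apply is_lim_seq_minus'; [|apply is_lim_seq_const].
    apply is_lim_seq_scal_l with (lu := Finite 1). exact (is_series_shift d a Hd Ha).
Qed.

(** For integers [k >= 1], [1 / (k + 1) >= 2/3 - k/6], because [(k - 1) * (k - 2) >= 0]; at [k = 0]
    there is a surplus of 1/3. *)
Lemma RInt_edge_gf_ge d a M :
  (1 <= d)%nat -> edge_distribution d a ->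
  (forall N, sum_n (fun k => INR k * a (S k)) N <= M) ->
  2 / 3 - M / 6 + a 1%nat / 3 <= RInt (edge_gf a) 0 1.
Proof.
  intros Hd Ha HM.
  assert (Hs : is_series (fun k => a (S k) / INR (S k) * 1 ^ S k) (RInt (edge_gf a) 0 1)).
  { apply is_RInt_edge_gf; [apply Ha|exists 1; apply Ha|lra]. }
  apply (is_lim_seq_le (fun N => 2 / 3 * sum_n (fun k => a (S k)) N + (a 1%nat / 3 - M / 6))
    (sum_n (fun k => a (S k) / INR (S k) * 1 ^ S k)) (2 / 3 - M / 6 + a 1%nat / 3)
    (RInt (edge_gf a) 0 1)); [| |exact Hs].
  - intros N.
    enough (H : 2 / 3 * sum_n (fun k => a (S k)) N + a 1%nat / 3
       - sum_n (fun k => INR k * a (S k)) N / 6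
       <= sum_n (fun k => a (S k) / INR (S k) * 1 ^ S k) N) by (specialize (HM N); lra).
    clear Hs. induction N as [|N IH].
    + rewrite !sum_O. simpl. lra.
    + rewrite !sum_Sn.
      change (2 / 3 * (sum_n (fun k => a (S k)) N + a (S (S N))) + a 1%nat / 3 -
        (sum_n (fun k => INR k * a (S k)) N + INR (S N) * a (S (S N))) / 6
        <= sum_n (fun k => a (S k) / INR (S k) * 1 ^ S k) N
           + a (S (S N)) / INR (S (S N)) * 1 ^ S (S N)).
      enough (2 / 3 * a (S (S N)) - INR (S N) * a (S (S N)) / 6
        <= a (S (S N)) / INR (S (S N)) * 1 ^ S (S N)) by lra.
      rewrite pow1. assert (Hp : 0 <= a (S (S N))) by apply Ha.
      assert (HI : / INR (S (S N)) >= 2/3 - INR (S N) / 6).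
      { rewrite (S_INR (S N)). pose proof (pos_INR (S N)).
        apply Rle_ge, Rmult_le_reg_r with (INR (S N) + 1); [lra|].
        rewrite Rinv_l by lra.
        assert (0 <= (INR (S N) - 1) * (INR (S N) - 2)); [|lra].
        rewrite S_INR. destruct N as [|N]; [simpl; lra|].
        rewrite S_INR. pose proof (pos_INR N). apply Rmult_le_pos; lra. }
      unfold Rdiv at 3. nra.
  - replace (2 / 3 - M / 6 + a 1%nat / 3) with (2 / 3 * 1 + (a 1%nat / 3 - M / 6)) by ring.
    apply is_lim_seq_plus'; [|apply is_lim_seq_const].
    apply is_lim_seq_scal_l with (lu := Finite 1). exact (is_series_shift d a Hd Ha).
Qed.

(** * Comparison of integrals with polynomials *)

Lemma is_RInt_quadratic c0 c1 c2 u v :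
  is_RInt (fun x => c0 + c1 * x + c2 * x ^ 2) u v
    (c0 * (v - u) + c1 * (v ^ 2 - u ^ 2) / 2 + c2 * (v ^ 3 - u ^ 3) / 3).
Proof.
  replace (c0 * (v - u) + c1 * (v ^ 2 - u ^ 2) / 2 + c2 * (v ^ 3 - u ^ 3) / 3)
    with (minus ((fun x => c0 * x + c1 * x ^ 2 / 2 + c2 * x ^ 3 / 3) v)
                ((fun x => c0 * x + c1 * x ^ 2 / 2 + c2 * x ^ 3 / 3) u))
    by (unfold minus, plus, opp; simpl; field).
  apply (is_RInt_derive (V := R_CompleteNormedModule)
    (fun x => c0 * x + c1 * x ^ 2 / 2 + c2 * x ^ 3 / 3)).
  - intros x _. auto_derive; [easy|]. field.
  - intros x _. apply (ex_derive_continuous (K := R_AbsRing) (V := R_NormedModule)). auto_derive; easy.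
Qed.

Lemma RInt_le_quadratic f c0 c1 c2 u v :
  u <= v -> ex_RInt f u v -> (forall x, u <= x <= v -> f x <= c0 + c1 * x + c2 * x ^ 2) ->
  RInt f u v <= c0 * (v - u) + c1 * (v ^ 2 - u ^ 2) / 2 + c2 * (v ^ 3 - u ^ 3) / 3.
Proof.
  intros Huv Hf H. assert (Hq := is_RInt_quadratic c0 c1 c2 u v).
  rewrite <- (is_RInt_unique _ _ _ _ Hq).
  apply RInt_le; auto; [eexists; exact Hq|]. intros x Hx. apply H; lra.
Qed.

Lemma RInt_ge_linear f c0 c1 u v :
  u <= v -> ex_RInt f u v -> (forall x, u <= x <= v -> c0 + c1 * x <= f x) ->
  c0 * (v - u) + c1 * (v ^ 2 - u ^ 2) / 2 <= RInt f u v.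
Proof.
  intros Huv Hf H. assert (Hq := is_RInt_quadratic c0 c1 0 u v).
  replace (c0 * (v - u) + c1 * (v ^ 2 - u ^ 2) / 2)
    with (c0 * (v - u) + c1 * (v ^ 2 - u ^ 2) / 2 + 0 * (v ^ 3 - u ^ 3) / 3) by lra.
  rewrite <- (is_RInt_unique _ _ _ _ Hq).
  apply RInt_le; auto; [eexists; exact Hq|]. intros x Hx. specialize (H x). lra.
Qed.

(** The constant is used up to [v - w], the line from there on. The best [w] is [h / s], but it
    stays free because the interval may be too short for it. *)
Lemma RInt_ge_corner f u v c h s w :
  0 <= w <= v - u -> ex_RInt f u v ->
  (forall x, u <= x <= v -> c <= f x) ->
  (forall x, u <= x <= v -> c + h - s * (v - x) <= f x) ->
  c * (v - u) + h * w - s * w ^ 2 / 2 <= RInt f u v.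
Proof.
  intros Hw Hf Hc Hs.
  assert (H1 : ex_RInt f u (v - w))
    by (apply (ex_RInt_Chasles_1 (V := R_CompleteNormedModule)) with v; [lra|auto]).
  assert (H2 : ex_RInt f (v - w) v)
    by (apply (ex_RInt_Chasles_2 (V := R_CompleteNormedModule)) with u; [lra|auto]).
  rewrite <- (RInt_Chasles f u (v - w) v) by assumption.
  apply (RInt_ge_linear f c 0) in H1; [|lra|intros x Hx; specialize (Hc x); lra].
  apply (RInt_ge_linear f (c + h - s * v) s) in H2; [|lra|intros x Hx; specialize (Hs x); lra].
  unfold plus; simpl. simpl in *. lra.
Qed.

(** * Inequalities for the first strip *)

(** For small [t] the two bounds on [a] force [D] to be small, and the moment inequality then gives
    [k] at most about [2 * z], with [z <= s]. *)
Lemma deficit_inequality_small s t D a k :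
  0 <= s -> 0 < t <= 2/5 -> 0 < D <= 1 -> 0 <= a -> 0 <= k <= 1 -> s <= 9/10 ->
  2 * (1 - a) <= (2 - k) * (1 + s + t * D) ->
  a <= s ^ 2 / (2 * (1 + s)) + t * D / 2 ->
  D * (1 - t) <= a ->
  k / 2 + k ^ 2 / 16 <= s * (1 - D / 3) + t - (1 - k) * t ^ 2 / 2.
Proof.
  intros Hs Ht HD Ha Hk Hs9 H1 H3 H4.
  (* With [s = 1 / lam_2 - 1], this is [1 - lam_2]. *)
  set (z := s / (1 + s)).
  assert (Hz : z * (1 + s) = s) by (unfold z; field; lra).
  assert (Hz0 : 0 <= z) by (unfold z; apply Rmult_le_pos; [lra|left; apply Rinv_0_lt_compat; lra]).
  assert (Hz1 : z <= 9/19) by nra.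
  replace (s ^ 2 / (2 * (1 + s))) with (s * z / 2) in H3 by (unfold z; field; lra).
  clearbody z.
  assert (HtD2 : t * D <= 2/5 * D) by (apply Rmult_le_compat_r; lra).
  (* The bounds on [a] give [D * (1 - 3/2 * t) <= s * z / 2], and [1 - 3/2 * t >= 2/5]. *)
  assert (HDw : D <= 5 / 4 * (s * z)) by nra.
  assert (HtD0 : 0 <= t * D) by (apply Rmult_le_pos; lra).
  assert (HkD : 0 <= k * (t * D)) by (apply Rmult_le_pos; lra).
  assert (Hk1 : k * (1 + s) <= 2 * s + s * z + 3 * (t * D)) by lra.
  assert (HtD : t * D <= t * (5 / 4 * (s * z))) by (apply Rmult_le_compat_l; lra).
  assert (Hk2 : k <= 2 * z + z ^ 2 + 15/4 * (t * z ^ 2)).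
  { apply Rmult_le_reg_r with (1 + s); [lra|].
    replace ((2 * z + z ^ 2 + 15 / 4 * (t * z ^ 2)) * (1 + s))
     with (2 * (z * (1+s)) + (z * (1+s)) * z + 15/4 * t * ((z * (1+s)) * z)) by ring.
    rewrite Hz. lra. }
  assert (Hz2 : 0 <= z ^ 2 <= 81/361) by nra.
  assert (Htz : 0 <= t * z ^ 2 <= t * (81/361)).
  { split; [apply Rmult_le_pos|apply Rmult_le_compat_l]; lra. }
  assert (Htz' : t * z ^ 2 <= 2/5 * z ^ 2) by (apply Rmult_le_compat_r; lra).
  assert (Hm : k * (1/2 + k/16) <= (2 * z + z ^ 2 + 15/4 * (t * z^2)) * (1/2 + k/16))
    by (apply Rmult_le_compat_r; lra).
  assert (Hm2 : t * z ^ 2 * (1/2 + k / 16) <= t * z ^ 2 * (9/16))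
    by (apply Rmult_le_compat_l; lra).
  assert (Hgap : (2*z+z^2)*(1/2+k/16) <= z + z ^ 2).
  { apply Rle_trans with ((2*z+z^2)*(1/2 + (2 * z + 5/2*z^2)/16)).
    - apply Rmult_le_compat_l; lra.
    - assert (0 <= z * z * (1/4 - 7/16 * z - 5/32 * z ^ 2)); [|lra].
      repeat apply Rmult_le_pos; lra. }
  assert (Hsz : z + z ^ 2 <= s - 5/12 * (s * s * z)).
  { assert (0 <= (s * z) * (z - 5/12 * s)); [|nra].
    apply Rmult_le_pos; [apply Rmult_le_pos; lra|nra]. }
  assert (H8 : s * D <= s * (5/4 * (s * z))) by (apply Rmult_le_compat_l; lra).
  assert (Ht2 : (1 - k) * t ^ 2 / 2 <= t / 5).
  { assert (t ^ 2 <= 2/5 * t) by nra. assert (0 <= t ^ 2) by nra. nra. }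
  lra.
Qed.
(** The right side increases with [t], so [t] may be lowered to 3/5 or 2/5. This settles everything
    but [t < 3/5] with [s < 3/10], where [k] has to be bounded more finely. *)
Lemma deficit_inequality_large s t D a k :
  0 <= s -> 2/5 <= t <= 1 -> 0 < D <= 1 -> 0 <= a -> 0 <= k <= 1 ->
  2 * (1 - a) <= (2 - k) * (1 + s + t * D) ->
  a <= s ^ 2 / (2 * (1 + s)) + t * D / 2 ->
  D * (1 + t) <= t ->
  k / 2 + k ^ 2 / 16 <= s * (1 - D / 3) + t - (1 - k) * t ^ 2 / 2.
Proof.
  intros Hs Ht HD Ha Hk H1 H3 H2.
  assert (HD2 : D <= 1/2) by nra.
  assert (Hk9 : k / 2 + k ^ 2 / 16 <= 9/16 * k) by nra.
  assert (Hsd : 5/6 * s <= s * (1 - D / 3)) by nra.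
  assert (Hmon : forall t0, 0 <= t0 <= t -> t0 - (1 - k) * t0 ^ 2 / 2 <= t - (1 - k) * t ^ 2 / 2).
  { intros t0 Ht0. assert (0 <= (t - t0) * (1 - (1 - k) * ((t + t0) / 2))); [|lra].
    apply Rmult_le_pos; [lra|]. nra. }
  destruct (Rle_dec (3/5) t) as [H6|H6].
  { specialize (Hmon (3/5)). lra. }
  assert (Ht2 := Hmon (2/5)).
  destruct (Rle_dec (3/10) s) as [Hs2|Hs2]; [lra|].
  assert (Hw : s ^ 2 / (2 * (1 + s)) <= s * 3/20).
  { apply Rmult_le_reg_r with (2 * (1+s)); [lra|]. field_simplify; [nra|lra]. }
  assert (Hk1 : k * (1 + s + t * D) <= 23/10 * s  + 3 * (t * D)) by lra.
  assert (Hu : t * D * (1 + t) <= t * t) by nra.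
  assert (Hu0 : 0 <= t * D) by (apply Rmult_le_pos; lra).
  set (u := t * D) in *. clearbody u.
  (* [t * t / (1 + t)] is convex with value 4/35 at 2/5, and this line lies above it up to 3/5. *)
  assert (Hu2 : u <= 4/35 + (t - 2/5)* (6/10)) by nra.
  destruct (Rle_dec (1/5) s) as [Hs5|Hs5].
  { lra. }
  assert (HkU : k * (4/35 + (t - 2/5) * (6/10) - u) <= 1 * (4/35 + (t - 2/5) * (6/10) - u))
    by (apply Rmult_le_compat_r; lra).
  assert (Hks : 0 <= k * s) by (apply Rmult_le_pos; lra).
  assert (Hkt : 0 <= k * (t - 2/5)) by (apply Rmult_le_pos; lra).
  assert (Hk2 : k * (39/35) <= 23/10 * s + 12/35 + 18/10 * (t - 2/5)) by lra.
  (* [(t - 2/5) * (t - 3/5) <= 0] on the remaining range. *)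
  assert (Htt : (1 - k) * t ^ 2 <= (1 - k) * (t - 6/25)) by (apply Rmult_le_compat_l; nra).
  lra.
Qed.

(* [s = 1 / lam_2 - 1], [D] is the height of the first strip, [a = rho_1],
   [t = (1 - p) / (q D)], [1 - k] is [q] times the slope of the chord of the
   check curve over the first step, and [1 / q = 1 + s + t D]. *)
Lemma deficit_inequality s t D a k :
  0 <= s -> 0 < t <= 1 -> 0 < D <= 1 -> 0 <= a -> 0 <= k <= 1 ->
  2 * (1 - a) <= (2 - k) * (1 + s + t * D) ->
  a <= s ^ 2 / (2 * (1 + s)) + t * D / 2 ->
  D * (1 - t) <= a ->
  D * (1 + t) <= t ->
  k / 2 + k ^ 2 / 16 <= s * (1 - D / 3) + t - (1 - k) * t ^ 2 / 2.
Proof.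
  intros Hs Ht HD Ha Hk H1 H2 H3 H4.
  destruct (Rle_dec t (2/5)) as [Ht5|Ht5].
  - destruct (Rle_dec s (9/10)) as [Hs9|Hs9].
    + apply (deficit_inequality_small s t D a k); auto; lra.
    (* Here [s * (1 - D / 3)] alone is at least 3/5, while the left side is at most 9/16. *)
    + assert (9/10 * (2/3) <= s * (1 - D / 3)) by (apply Rmult_le_compat; lra).
      assert (0 <= t * (1 - (1 - k) * (t / 2))).
      { apply Rmult_le_pos; [lra|]. nra. }
      assert (k ^ 2 <= k) by nra. lra.
  - apply (deficit_inequality_large s t D a k); auto; lra.
Qed.

(** Division by [q * D ^ 2] leads to [deficit_inequality]. Here [ell], [a], [b] stand for [lam_2],
    [rho_1], [rho_2], [s0] for the slope of the first chord of the check curve and [A0] for the area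
    of the first strip. The hypothesis [1 - p < p * ell * D] says that a triangle of slope [1 / q]
    would be cut off at [x = 1]. *)
Lemma first_strip p ell D a b s0 A0 :
  0 < p < 1 -> 0 < ell <= 1 -> 0 < D <= 1 -> 0 <= a <= 1 -> b <= s0 ->
  0 <= s0 -> p * ell * s0 <= 1 -> 1 - p < p * ell * D -> D <= a + (1 - a) * (1 - p) ->
  2 - 2 * a - b <= 1 / (p * ell) ->
  2 / 3 - 1 / (p * ell) / 6 + a / 3 <= 1 / 3 + ell / 6 ->
  A0 <= (1 - p) / 2 ->
  p * (ell * D ^ 2 / 2 + (1 - ell) * (D ^ 2 - D ^ 3 / 3)) + (1 - p) * D - s0 * (1 - p) ^ 2 / 2 <= A0 ->
  let k := 1 - p * ell * s0 in
  p * ell * (D ^ 2 * (1 / 2 + k / 2 + k ^ 2 / 16)) <= A0.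
Proof.
  intros Hp Hl HD Ha Hb Hs0 Hs1 Hbad HD2 Hi Hiii HA HA0 k.
  set (q := p * ell) in *.
  assert (Hq : 0 < q) by (apply Rmult_lt_0_compat; lra).
  set (s := / ell - 1).
  assert (Hse : (1 + s) * ell = 1) by (unfold s; field; lra).
  assert (Hs : 0 <= s) by nra.
  assert (HqD : 0 < q * D) by (apply Rmult_lt_0_compat; lra).
  set (t := (1 - p) / (q * D)).
  assert (Ht : t * (q * D) = 1 - p) by (unfold t; field; lra).
  assert (Ht0 : 0 < t) by (apply Rdiv_lt_0_compat; lra).
  assert (Ht1 : t < 1) by nra.
  assert (Hiq : 1 / q = 1 + s + t * D).
  { apply Rmult_eq_reg_r with q; [|lra]. unfold Rdiv. rewrite Rmult_1_l, Rinv_l by lra.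
    assert ((1 + s) * q = p) by (unfold q; replace ((1 + s) * (p * ell)) with (p * ((1 + s) * ell)) by ring; rewrite Hse; ring).
    lra. }
  rewrite Hiq in Hi, Hiii.
  assert (Hk : 0 <= k <= 1).
  { unfold k. assert (0 <= q * s0) by (apply Rmult_le_pos; lra). lra. }
  assert (Hlow : p * (ell * D ^ 2 / 2 + (1 - ell) * (D ^ 2 - D ^ 3 / 3)) + (1 - p) * D - s0 * (1 - p) ^ 2 / 2
    = q * (D ^ 2 * (1 / 2 + (s * (1 - D / 3) + t - (1 - k) * t ^ 2 / 2)))).
  { rewrite <- Ht. unfold k.
    replace (p * (ell * D ^ 2 / 2 + (1 - ell) * (D ^ 2 - D ^ 3 / 3)))
      with (q * (D ^ 2 * (1 / 2 + s * (1 - D / 3)))); [field|].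
    replace (1 - ell) with (s * ell) by lra. unfold q. field. }
  rewrite Hlow in HA0.
  assert (HqD2 : 0 < q * D ^ 2) by (apply Rmult_lt_0_compat; [lra|apply pow_lt; lra]).
  assert (Hst : k / 2 + k ^ 2 / 16 <= s * (1 - D / 3) + t - (1 - k) * t ^ 2 / 2).
  { apply (deficit_inequality s t D a k); auto.
    - lra.
    - lra.
    - assert (Hb2 : b <= (1 - k) * (1 + s + t * D)).
      { rewrite <- Hiq. unfold k. replace ((1 - (1 - q * s0)) * (1 / q)) with s0 by (field; lra). lra. }
      lra.
    - replace (s ^ 2 / (2 * (1 + s))) with ((s - 1 + ell) / 2); [lra|].
      unfold s. field. lra.
    (* [D <= a + (1 - p)], and [1 - p = t * q * D <= t * D]. *)
    - assert (q <= 1 * 1) by (apply Rmult_le_compat; lra).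
      assert (1 - p <= t * D).
      { rewrite <- Ht. assert (0 <= t * D * (1 - q)); [|lra].
        apply Rmult_le_pos; [apply Rmult_le_pos|]; lra. }
      assert (0 <= a * (1 - p)) by (apply Rmult_le_pos; lra). lra.
    (* Comparing the lower bound on [A0] with its upper bound [t * q * D / 2] yields
       [D * (1 + t) <= t]. *)
    - assert (0 <= s * (1 - D / 3)) by (apply Rmult_le_pos; lra).
      assert ((1 - k) * t ^ 2 <= t).
      { assert (0 < t ^ 2) by nra. nra. }
      assert (q * (D ^ 2 * (1 / 2 + t / 2)) <= (1 - p) / 2).
      { apply Rle_trans with (2 := HA). apply Rle_trans with (2 := HA0).
        rewrite <- !Rmult_assoc. apply Rmult_le_compat_l; lra. }
      rewrite <- Ht in H1.
      apply Rmult_le_reg_l with (q * D); [lra|]. lra. }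
  apply Rle_trans with (2 := HA0).
  rewrite <- !Rmult_assoc. apply Rmult_le_compat_l; lra.
Qed.

(** * Cauchy-Schwarz with a deficit in the first step *)

(* [Y l] are the heights of the staircase and [A l] is the area above height
   [Y (S l)], divided by [q]; [D] is the deficit of the first strip. *)
Lemma sequence_bound (Y A : nat -> R) (H C D : R) :
  let d l := Y l - Y (S l) in
  Y 0%nat = 1 ->
  is_lim_seq Y 0 ->
  (forall l, 0 < d l) ->
  (forall N, A N <= H + C * Y (S N)) ->
  d 0%nat ^ 2 - D <= A 0%nat ->
  D <= d 0%nat ^ 2 / 2 ->
  (D <= 0 \/ d 0%nat <= d 1%nat \/
   D <= d 0%nat * d 1%nat / 2 - (d 0%nat - d 1%nat) ^ 2 / 16) ->
  (forall l, d (S l) ^ 2 <= A (S l) - A l) ->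
  (forall l, d (S l) ^ 2 * (1 + d (S l) / d (S (S l))) / 2 <= A (S l) - A l) ->
  forall m, (1 - Y (S m)) ^ 2 <= INR (S m) * H.
Proof.
  intros d HY0 HYlim Hd HA HA0 HD2 HD Hs1 Hs2.
  assert (Hdlim : is_lim_seq d 0).
  { replace 0 with (0 - 0) by ring. apply is_lim_seq_minus'; [exact HYlim|].
    now apply is_lim_seq_incr_1 in HYlim. }
  (* For a ratio [r >= 1] of consecutive steps the excess is a multiple of [(r - 2) ^ 2 * (r + 1)].
     The bound telescopes: [A l + 2 * d (S l) ^ 2] is nondecreasing. *)
  assert (Hst : forall l, 2 * d (S l) ^ 2 - 2 * d (S (S l)) ^ 2 <= A (S l) - A l).
  { intros l. specialize (Hs1 l). specialize (Hs2 l).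
    set (u := d (S l)) in *. assert (Hv := Hd (S (S l))). set (v := d (S (S l))) in *.
    assert (Hu : 0 < u) by apply Hd. clearbody u v.
    destruct (Rle_dec u v); [nra|].
    set (r := u / v) in *. assert (Hr : r * v = u) by (unfold r; field; lra). clearbody r.
    assert (1 <= r) by nra.
    subst u. assert (0 < v^2) by nra.
    assert (0 <= v ^ 2 * ((r - 2) ^ 2 * (r + 1))).
    { apply Rmult_le_pos; [lra|]. apply Rmult_le_pos; [apply pow2_ge_0|lra]. }
    lra. }
  (* The area left below [Y (S l)] is a reserve that helps to pay for the deficit. *)
  assert (Htail : forall l, A l + 2 * d (S l) ^ 2 <= H).
  { intros l.
    assert (HN : forall N, A l + 2 * d (S l) ^ 2 <= A (N + l)%nat + 2 * d (S (N + l)) ^ 2).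
    { induction N as [|N IH]; [simpl; lra|]. specialize (Hst (N + l)%nat).
      change (S N + l)%nat with (S (N + l)). lra. }
    apply (is_lim_seq_le (fun _ => A l + 2 * d (S l) ^ 2)
             (fun N => (H + C * Y (S (N + l))) + 2 * d (S (N + l)) ^ 2) (A l + 2 * d (S l) ^ 2) H).
    - intros N. specialize (HN N). specialize (HA (N + l)%nat). lra.
    - apply is_lim_seq_const.
    - replace (Finite H) with (Finite (H + C * 0 + 2 * (0 * 0))) by (f_equal; ring).
      apply is_lim_seq_plus'.
      + apply is_lim_seq_plus'; [apply is_lim_seq_const|].
        apply is_lim_seq_scal_l with (lu := Finite 0).
        apply is_lim_seq_ext with (fun N => Y (N + S l)%nat);
          [intros N; f_equal; lia|now apply is_lim_seq_incr_n].
      + apply is_lim_seq_scal_l with (lu := Finite (0 * 0)).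
        apply is_lim_seq_ext with (fun N => d (N + S l)%nat * d (N + S l)%nat).
        { intros N. replace (N + S l)%nat with (S (N + l)) by lia. ring. }
        apply is_lim_seq_mult'; apply (is_lim_seq_incr_n d (S l)); exact Hdlim. }
  intros m.
  assert (Hd0 := Hd 0%nat). assert (Hd1 := Hd 1%nat).
  assert (Ht0 := Htail 0%nat).
  (* One or two steps need only the first strip and the reserve below it. *)
  destruct m as [|[|l]].
  - simpl INR. replace (1 - Y 1%nat) with (d 0%nat) by (unfold d; lra).
    set (u := d 0%nat) in *; set (v := d 1%nat) in *; clearbody u v.
    assert (0 < u * v) by (apply Rmult_lt_0_compat; lra).
    assert (0 <= (u - 5 * v) ^ 2) by apply pow2_ge_0.
    assert (0 <= v ^ 2) by apply pow2_ge_0.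
    enough (D <= 2 * v ^ 2) by lra.
    destruct HD as [HD|[HD|HD]]; [lra|nra|lra].
  - simpl INR. replace (1 - Y 2%nat) with (d 0%nat + d 1%nat) by (unfold d; lra).
    set (u := d 0%nat) in *; set (v := d 1%nat) in *; clearbody u v.
    assert (0 < u * v) by (apply Rmult_lt_0_compat; lra).
    assert (0 <= (u - 3/2 * v) ^ 2) by apply pow2_ge_0.
    assert (0 <= (u - v) ^ 2) by apply pow2_ge_0.
    assert (0 <= v ^ 2) by apply pow2_ge_0.
    enough (D <= u ^ 2 / 2 + 3/2 * v ^ 2 - u * v) by lra.
    destruct HD as [HD|[HD|HD]]; [lra|nra|lra].
  (* [mu] is the mean step. The tangent bound [d ^ 2 >= 2 * mu * d - mu ^ 2] replaces Cauchy-Schwarz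
     for the middle steps; the first two steps and the last keep their squares. *)
  - set (mu := (1 - Y (S (S (S l)))) / INR (S (S (S l)))).
    assert (Hmid : forall i, A (S i) >= A 0%nat + d 1%nat ^ 2 + (d 1%nat ^ 2 - d (S (S i)) ^ 2) / 4
       + 2 * mu * (Y 2%nat - Y (S (S i))) - INR i * mu ^ 2).
    (* A telescoping surplus: for a ratio [r >= 1] the excess is a multiple of
       [(r - 1) ^ 2 * (2 * r + 1)]. *)
    { assert (Hq : forall i, d (S i) ^ 2 + (d (S i) ^ 2 - d (S (S i)) ^ 2) / 4 <= A (S i) - A i).
      { intros i. specialize (Hs1 i). specialize (Hs2 i).
        set (u := d (S i)) in *. assert (Hv := Hd (S (S i))). set (v := d (S (S i))) in *.
        assert (Hu : 0 < u) by apply Hd. clearbody u v.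
        destruct (Rle_dec u v); [nra|].
        set (r := u / v) in *. assert (Hr : r * v = u) by (unfold r; field; lra). clearbody r.
        assert (1 <= r) by nra.
        subst u. assert (0 < v^2) by nra.
        assert (0 <= v ^ 2 * ((r - 1) ^ 2 * (2 * r + 1))).
        { apply Rmult_le_pos; [lra|]. apply Rmult_le_pos; [apply pow2_ge_0|lra]. }
        lra. }
      induction i as [|i IH]; [specialize (Hq 0%nat); simpl INR; lra|].
      specialize (Hq (S i)). rewrite S_INR.
      assert (0 <= (d (S (S i)) - mu) ^ 2) by apply pow2_ge_0.
      assert (E : Y (S (S i)) - Y (S (S (S i))) = d (S (S i))) by reflexivity.
      nra. }
    specialize (Hmid l). assert (Ht := Htail (S l)).
    assert (Hm : 1 - Y (S (S (S l))) = mu * (INR l + 3)).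
    { unfold mu. rewrite !S_INR. field. pose proof (pos_INR l). lra. }
    rewrite Hm.
    assert (HX : 1 - Y (S (S (S l))) = d 0%nat + d 1%nat + (Y 2%nat - Y (S (S l))) + d (S (S l)))
      by (unfold d; lra).
    rewrite Hm in HX.
    replace (INR (S (S (S l)))) with (INR l + 3) by (rewrite !S_INR; ring).
    assert (HM := pos_INR l). set (M := INR l) in *. clearbody M.
    set (z := Y 2%nat - Y (S (S l))) in *. clearbody z.
    assert (HmidX : A (S l) >= A 0%nat + d 1%nat ^ 2 + (d 1%nat ^ 2 - d (S (S l)) ^ 2) / 4
       + 2 * mu * (mu * (M + 3) - d 0%nat - d 1%nat - d (S (S l))) - M * mu ^ 2).
    { replace (mu * (M + 3) - d 0%nat - d 1%nat - d (S (S l))) with z by lra. exact Hmid. }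
    assert (Hx := Hd (S (S l))).
    assert (Hgoal : mu ^ 2 * (M + 3) <= H); [|nra].
    set (u := d 0%nat) in *; set (v := d 1%nat) in *; set (x := d (S (S l))) in *.
    set (A0 := A 0%nat) in *. set (A1 := A (S l)) in *.
    clearbody u v x A0 A1. clear - HA0 HD2 HD HmidX Ht Hd0 Hd1 Hx.
    assert (D <= (u - mu) ^ 2 + (v - mu)^2 + (x - mu)^2 + (v^2 - x^2)/4 + x^2); [|lra].
    (* Minimize over [mu], at the mean of [u], [v], [x], and then over [x], at
       [4 * (u + v) / 17]. *)
    assert (0 <= (3*mu - u - v - x)^2) by apply pow2_ge_0.
    apply Rle_trans with (((u-v)^2+(u-x)^2+(v-x)^2)/3 + (v^2 - x^2)/4 + x^2); [|lra].
    assert (0 <= (17 * x - 4 * u - 4 * v)^2) by apply pow2_ge_0.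
    assert (HF : 30/51 * u ^ 2 + 57/68 * v ^ 2 - 42/51 * (u * v)
      <= ((u-v)^2+(u-x)^2+(v-x)^2)/3 + (v^2 - x^2)/4 + x^2) by lra.
    assert (0 < u * v) by (apply Rmult_lt_0_compat; lra).
    assert (0 <= (u - 9/8 * v) ^ 2) by apply pow2_ge_0.
    destruct HD as [HD|[HD|HD]].
    + assert (0 <= v ^ 2) by apply pow2_ge_0. lra.
    + nra.
    + assert (0 <= v ^ 2) by apply pow2_ge_0. assert (0 <= (u - v) ^ 2) by apply pow2_ge_0. lra.
Qed.

(** * The staircase of density evolution *)

(* Shifted by one with respect to [message_erasure]: index [S l] is the check-to-variable
   erasure probability of iteration [l], and index [0] stands for the state before any
   iteration, so that [message_erasure_check] holds at every index. *)
Definition check_erasure (lam rho : nat -> R) (p : R) (l : nat) : R :=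
  match l with
  | O => 1
  | S l' => 1 - edge_gf rho (1 - message_erasure lam rho p l')
  end.

(** Standing assumptions of the area argument, supplied by [bit_erasure_decoding]. Successful
    decoding is expressed through the check messages. *)
Record decoding (lam rho : nat -> R) (p : R) : Prop := {
  dec_p : 0 < p < 1;
  dec_lam : edge_distribution 2 lam;
  dec_rho : edge_distribution 1 rho;
  dec_lam2 : 0 < lam 2%nat;
  dec_rho1 : rho 1%nat < 1;
  dec_lim : is_lim_seq (check_erasure lam rho p) 0
}.

Lemma message_erasure_check lam rho p l :
  edge_distribution 2 lam ->
  message_erasure lam rho p l = p * edge_gf lam (check_erasure lam rho p l).
Proof.
  intros Hl. destruct l as [|l]; simpl; [|reflexivity].
  rewrite (edge_gf_1 2) by (auto; lia). ring.
Qed.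

Lemma lam2_mul_le lam y :
  edge_distribution 2 lam -> 0 <= y <= 1 -> lam 2%nat * y <= edge_gf lam y.
Proof.
  intros Hl Hy. assert (H := edge_gf_increment 2 lam 0 y ltac:(lia) Hl ltac:(lra) ltac:(lra)).
  rewrite edge_gf_0 in H. destruct Hl as (_ & H0 & _). rewrite (H0 1%nat) in H by lia. lra.
Qed.

Lemma edge_gf_le_id lam y :
  edge_distribution 2 lam -> 0 <= y <= 1 -> edge_gf lam y <= y.
Proof.
  intros Hl Hy. assert (H := edge_gf_le_quadratic lam y Hl Hy).
  assert (H1 := edge_coef_le_1 2 lam 2 Hl).
  assert (0 <= (1 - lam 2%nat) * (y * (1 - y))) by (repeat apply Rmult_le_pos; lra). lra.
Qed.

Lemma erasures_pos lam rho p l : decoding lam rho p ->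
  0 < check_erasure lam rho p l <= 1 /\ 0 < message_erasure lam rho p l <= p.
Proof.
  intros [Hp Hl Hr Hl2 Hr1 _].
  assert (Hx : forall l, 0 < check_erasure lam rho p l <= 1 -> 0 < message_erasure lam rho p l <= p).
  { intros l' Hy. rewrite message_erasure_check by auto.
    assert (H1 := lam2_mul_le lam _ Hl ltac:(split; [apply Rlt_le|]; apply Hy)).
    assert (H2 := edge_gf_bound 2 lam (check_erasure lam rho p l') ltac:(lia) Hl ltac:(lra)).
    assert (0 < lam 2%nat * check_erasure lam rho p l') by (apply Rmult_lt_0_compat; lra).
    split; [apply Rmult_lt_0_compat; lra|nra]. }
  enough (Hy : 0 < check_erasure lam rho p l <= 1) by auto.
  induction l as [|l IH]; [simpl; lra|].
  apply Hx in IH. simpl. set (x := message_erasure lam rho p l) in *. clearbody x.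
  (* Concavity of the check curve bounds its height at [x] from below by [(1 - rho_1) * x]. *)
  assert (H := edge_gf_convex 1 rho 0 (1 - x) 1 ltac:(lia) Hr ltac:(lra) ltac:(lra)).
  rewrite (edge_gf_1 1) in H by (auto; lia). rewrite edge_gf_0 in H.
  assert (H1 := edge_gf_bound 1 rho (1 - x) ltac:(lia) Hr ltac:(lra)).
  assert (0 < (1 - rho 1%nat) * x) by (apply Rmult_lt_0_compat; lra). lra.
Qed.

Lemma check_erasure_le lam rho p l : decoding lam rho p ->
  check_erasure lam rho p (S l) <= check_erasure lam rho p l.
Proof.
  intros H. induction l as [|l IH].
  - apply (erasures_pos lam rho p 1 H).
  - assert (Hx0 := erasures_pos lam rho p l H). assert (Hx1 := erasures_pos lam rho p (S l) H).
    assert (Hx : message_erasure lam rho p (S l) <= message_erasure lam rho p l).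
    { rewrite !message_erasure_check by apply H. apply Rmult_le_compat_l; [apply Rlt_le, H|].
      apply (edge_gf_le 2); [lia|apply H|lra|lra]. }
    assert (Hp := dec_p _ _ _ H).
    change (1 - edge_gf rho (1 - message_erasure lam rho p (S l)) <=
            1 - edge_gf rho (1 - message_erasure lam rho p l)).
    assert (Hr := edge_gf_le 1 rho (1 - message_erasure lam rho p l)
      (1 - message_erasure lam rho p (S l)) ltac:(lia) (dec_rho _ _ _ H) ltac:(lra) ltac:(lra)).
    lra.
Qed.

(** Two equal consecutive values would make the sequence constant from there on, at a positive
    value. *)
Lemma check_erasure_lt lam rho p l : decoding lam rho p ->
  check_erasure lam rho p (S l) < check_erasure lam rho p l.
Proof.
  intros H. destruct (check_erasure_le lam rho p l H) as [Hlt|Heq]; [exact Hlt|exfalso].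
  assert (Hc : forall n, check_erasure lam rho p (n + l) = check_erasure lam rho p l
     /\ check_erasure lam rho p (S (n + l)) = check_erasure lam rho p l).
  { induction n as [|n [IH1 IH2]]; [auto|]. split; [exact IH2|].
    transitivity (check_erasure lam rho p (S l)); [|exact Heq].
    change (1 - edge_gf rho (1 - message_erasure lam rho p (S (n + l))) =
            1 - edge_gf rho (1 - message_erasure lam rho p l)).
    rewrite !message_erasure_check by apply H. now rewrite IH2. }
  assert (Hlim := dec_lim _ _ _ H). apply (is_lim_seq_incr_n _ l) in Hlim.
  apply (is_lim_seq_ext _ (fun _ => check_erasure lam rho p l)) in Hlim; [|intros n; apply Hc].
  apply is_lim_seq_unique in Hlim. rewrite Lim_seq_const in Hlim. injection Hlim as Hlim.
  assert (Hpos := erasures_pos lam rho p l H). lra.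
Qed.

Lemma message_erasure_decrease lam rho p l : decoding lam rho p ->
  p * lam 2%nat * (check_erasure lam rho p l - check_erasure lam rho p (S l))
  <= message_erasure lam rho p l - message_erasure lam rho p (S l).
Proof.
  intros H. assert (H0 := erasures_pos lam rho p l H).
  assert (H1 := erasures_pos lam rho p (S l) H). assert (Hd := check_erasure_le lam rho p l H).
  rewrite !message_erasure_check by apply H.
  assert (Hi := edge_gf_increment 2 lam (check_erasure lam rho p (S l))
    (check_erasure lam rho p l) ltac:(lia) (dec_lam _ _ _ H) ltac:(lra) ltac:(lra)).
  assert (Hp := dec_p _ _ _ H).
  rewrite Rmult_assoc, <- Rmult_minus_distr_l. apply Rmult_le_compat_l; lra.
Qed.

Lemma message_erasure_ge lam rho p l : decoding lam rho p ->
  p * lam 2%nat * check_erasure lam rho p l <= message_erasure lam rho p l.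
Proof.
  intros H. rewrite message_erasure_check by apply H. rewrite Rmult_assoc.
  assert (Hp := dec_p _ _ _ H). assert (H0 := erasures_pos lam rho p l H).
  apply Rmult_le_compat_l; [lra|]. apply lam2_mul_le; [apply H|lra].
Qed.

(** The check curve is concave and passes through the origin, so its chord is at most as steep as
    [y2 / x1], and [q * y2 <= x1]. *)
Lemma chord_slope_le lam rho p l : decoding lam rho p ->
  p * lam 2%nat * (check_erasure lam rho p (S l) - check_erasure lam rho p (S (S l)))
  <= message_erasure lam rho p l - message_erasure lam rho p (S l).
Proof.
  intros H. assert (Hp := dec_p _ _ _ H).
  assert (H0 := erasures_pos lam rho p l H).
  assert (H1 := erasures_pos lam rho p (S l) H). assert (H2 := erasures_pos lam rho p (S (S l)) H).
  assert (Hl2 := dec_lam2 _ _ _ H).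
  assert (Hq : 0 < p * lam 2%nat) by (apply Rmult_lt_0_compat; lra).
  assert (Hge := message_erasure_ge lam rho p (S (S l)) H).
  assert (Hd1 := message_erasure_decrease lam rho p (S l) H).
  assert (Hd0 := message_erasure_decrease lam rho p l H).
  assert (Hc0 := check_erasure_lt lam rho p l H).
  assert (Hc1 := check_erasure_lt lam rho p (S l) H).
  assert (0 < p * lam 2%nat * (check_erasure lam rho p (S l) - check_erasure lam rho p (S (S l))))
    by (apply Rmult_lt_0_compat; lra).
  assert (0 < p * lam 2%nat * (check_erasure lam rho p l - check_erasure lam rho p (S l)))
    by (apply Rmult_lt_0_compat; lra).
  set (x0 := message_erasure lam rho p l) in *.
  set (x1 := message_erasure lam rho p (S l)) in *.
  set (q := p * lam 2%nat) in *.
  assert (Hconv := edge_gf_convex 1 rho (1 - x0) (1 - x1) 1 ltac:(lia) (dec_rho _ _ _ H)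
    ltac:(lra) ltac:(lra)).
  rewrite (edge_gf_1 1) in Hconv by (try apply H; lia).
  assert (E1 : check_erasure lam rho p (S l) = 1 - edge_gf rho (1 - x0)) by reflexivity.
  assert (E2 : check_erasure lam rho p (S (S l)) = 1 - edge_gf rho (1 - x1)) by reflexivity.
  set (y1 := check_erasure lam rho p (S l)) in *. set (y2 := check_erasure lam rho p (S (S l))) in *.
  replace (edge_gf rho (1 - x1)) with (1 - y2) in Hconv by lra.
  replace (edge_gf rho (1 - x0)) with (1 - y1) in Hconv by lra.
  assert (Hq2 : q * y2 <= x1) by lra.
  apply Rmult_le_reg_l with x1; [lra|].
  apply Rle_trans with (q * (y2 * (x0 - x1))).
  - replace (x1 * (q * (y1 - y2))) with (q * ((y1 - y2) * x1)) by ring.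
    apply Rmult_le_compat_l; lra.
  - rewrite <- Rmult_assoc. apply Rmult_le_compat_r; lra.
Qed.

Lemma message_erasure_lim lam rho p : decoding lam rho p ->
  is_lim_seq (message_erasure lam rho p) 0.
Proof.
  intros H. apply (is_lim_seq_le_le (fun _ => 0) _ (check_erasure lam rho p));
    [|apply is_lim_seq_const|apply H].
  intros l. assert (H0 := erasures_pos lam rho p l H). split; [lra|].
  rewrite message_erasure_check by apply H. assert (Hp := dec_p _ _ _ H).
  assert (H1 := edge_gf_le_id lam (check_erasure lam rho p l) (dec_lam _ _ _ H) ltac:(lra)).
  assert (H2 := edge_gf_bound 2 lam (check_erasure lam rho p l) ltac:(lia) (dec_lam _ _ _ H) ltac:(lra)).
  nra.
Qed.

(** The stability condition [q * rho'(1) <= 1], obtained from chords over the shrinking lengths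
    [x_n], since [q * y_(n+1) <= x_n]. *)
Lemma decoding_moment lam rho p : decoding lam rho p ->
  forall N, sum_n (fun k => INR k * rho (S k)) N <= 1 / (p * lam 2%nat).
Proof.
  intros H N. assert (Hp := dec_p _ _ _ H). assert (Hl2 := dec_lam2 _ _ _ H).
  assert (Hq : 0 < p * lam 2%nat) by (apply Rmult_lt_0_compat; lra).
  apply (moment_le 1 rho _ (message_erasure lam rho p)); [lia|apply H| |now apply message_erasure_lim|].
  - intros n. assert (H0 := erasures_pos lam rho p n H). lra.
  - intros n. change (check_erasure lam rho p (S n) <= message_erasure lam rho p n * (1 / (p * lam 2%nat))).
    apply Rmult_le_reg_r with (p * lam 2%nat); [lra|].
    replace (message_erasure lam rho p n * (1 / (p * lam 2%nat)) * (p * lam 2%nat))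
      with (message_erasure lam rho p n) by (field; lra).
    assert (H1 := message_erasure_ge lam rho p (S n) H).
    assert (H2 := message_erasure_decrease lam rho p n H).
    assert (H3 := check_erasure_le lam rho p n H).
    assert (0 <= p * lam 2%nat * (check_erasure lam rho p n - check_erasure lam rho p (S n)))
      by (apply Rmult_le_pos; lra).
    lra.
Qed.

(** * The area between the two curves and its horizontal strips *)

Definition gap lam rho p := RInt (edge_gf rho) 0 1 - p * RInt (edge_gf lam) 0 1.

(* The area between the two curves at heights above [check_erasure (S N)]. *)
Definition staircase_area lam rho p N :=
  RInt (edge_gf rho) 0 (1 - message_erasure lam rho p N)
  - p * RInt (edge_gf lam) (check_erasure lam rho p (S N)) 1
  + message_erasure lam rho p N * (1 - check_erasure lam rho p (S N)).

Lemma RInt_edge_gf_Chasles d a x y z :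
  edge_distribution d a -> 0 <= x <= y -> y <= z <= 1 ->
  RInt (edge_gf a) x z = RInt (edge_gf a) x y + RInt (edge_gf a) y z.
Proof.
  intros Ha Hx Hy. symmetry.
  apply (RInt_Chasles (V := R_CompleteNormedModule)); apply (ex_RInt_edge_gf d); auto; lra.
Qed.

(** Below the height [y] of the cut only the crude bound [- p * y] on the remaining area is used; it
    vanishes in the limit. *)
Lemma staircase_area_le lam rho p N : decoding lam rho p ->
  staircase_area lam rho p N <= gap lam rho p + p * check_erasure lam rho p (S N).
Proof.
  intros H. assert (Hp := dec_p _ _ _ H). assert (Hl := dec_lam _ _ _ H).
  assert (Hr := dec_rho _ _ _ H).
  unfold staircase_area, gap.
  assert (H0 := erasures_pos lam rho p N H). assert (H1 := erasures_pos lam rho p (S N) H).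
  set (x := message_erasure lam rho p N) in *.
  assert (Ey : edge_gf rho (1 - x) = 1 - check_erasure lam rho p (S N)) by (simpl; fold x; ring).
  set (y := check_erasure lam rho p (S N)) in *. clearbody x y.
  rewrite (RInt_edge_gf_Chasles 1 rho 0 (1 - x) 1), (RInt_edge_gf_Chasles 2 lam 0 y 1) by (auto; lra).
  assert (Ir : (1 - y) * (1 - (1 - x)) + 0 * (1 ^ 2 - (1 - x) ^ 2) / 2 <= RInt (edge_gf rho) (1 - x) 1).
  { apply RInt_ge_linear; [lra|apply (ex_RInt_edge_gf 1); auto; lra|].
    intros t Ht. rewrite <- Ey. assert (Hm := edge_gf_le 1 rho (1 - x) t ltac:(lia) Hr ltac:(lra) ltac:(lra)). lra. }
  assert (Il : RInt (edge_gf lam) 0 y <= 1 * (y - 0) + 0 * (y ^ 2 - 0 ^ 2) / 2 + 0 * (y ^ 3 - 0 ^ 3) / 3).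
  { apply RInt_le_quadratic; [lra|apply (ex_RInt_edge_gf 2); auto; lra|].
    intros t Ht. assert (Hb := edge_gf_bound 2 lam t ltac:(lia) Hl ltac:(lra)). lra. }
  assert (p * RInt (edge_gf lam) 0 y <= p * y) by (apply Rmult_le_compat_l; lra).
  lra.
Qed.

(** By convexity the graph of [rho] lies above the extension of a chord beyond its endpoint. *)
Lemma rho_above_chord lam rho p l t : decoding lam rho p ->
  0 <= t <= 1 - message_erasure lam rho p l ->
  1 - check_erasure lam rho p (S l)
  - (check_erasure lam rho p (S l) - check_erasure lam rho p (S (S l)))
    / (message_erasure lam rho p l - message_erasure lam rho p (S l))
    * (1 - message_erasure lam rho p l - t) <= edge_gf rho t.
Proof.
  intros H Ht. assert (Hp := dec_p _ _ _ H).
  assert (H0 := erasures_pos lam rho p l H). assert (H1 := erasures_pos lam rho p (S l) H).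
  assert (Hc := check_erasure_lt lam rho p l H).
  assert (Hd := message_erasure_decrease lam rho p l H).
  assert (Hq : 0 < p * lam 2%nat) by (apply Rmult_lt_0_compat; apply H).
  assert (0 < p * lam 2%nat * (check_erasure lam rho p l - check_erasure lam rho p (S l)))
    by (apply Rmult_lt_0_compat; lra).
  assert (Hconv := edge_gf_convex 1 rho t (1 - message_erasure lam rho p l)
    (1 - message_erasure lam rho p (S l)) ltac:(lia) (dec_rho _ _ _ H) ltac:(lra) ltac:(lra)).
  change (check_erasure lam rho p (S l)) with (1 - edge_gf rho (1 - message_erasure lam rho p l)).
  change (check_erasure lam rho p (S (S l))) with (1 - edge_gf rho (1 - message_erasure lam rho p (S l))).
  set (x0 := message_erasure lam rho p l) in *. set (x1 := message_erasure lam rho p (S l)) in *.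
  set (r0 := edge_gf rho (1 - x0)) in *. set (r1 := edge_gf rho (1 - x1)) in *.
  apply Rmult_le_reg_r with (x0 - x1); [lra|].
  field_simplify; [|lra]. lra.
Qed.

(** The vertical line through [x_(l+1)] cuts the strip in two. The left part contains a triangle
    because [p lam] has slope at least [q], the right part one bounded by the extended chord of
    slope [s]. *)
Lemma staircase_area_step lam rho p l : decoding lam rho p ->
  let d := check_erasure lam rho p (S l) - check_erasure lam rho p (S (S l)) in
  let s := (check_erasure lam rho p (S (S l)) - check_erasure lam rho p (S (S (S l))))
           / (message_erasure lam rho p (S l) - message_erasure lam rho p (S (S l))) in
  p * lam 2%nat * d ^ 2 / 2 + d ^ 2 / (2 * s)
  <= staircase_area lam rho p (S l) - staircase_area lam rho p l.
Proof.
  intros H d s. assert (Hp := dec_p _ _ _ H). assert (Hl := dec_lam _ _ _ H).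
  assert (Hr := dec_rho _ _ _ H).
  assert (Hq : 0 < p * lam 2%nat) by (apply Rmult_lt_0_compat; apply H).
  assert (H0 := erasures_pos lam rho p l H). assert (H1 := erasures_pos lam rho p (S l) H).
  assert (H2 := erasures_pos lam rho p (S (S l)) H).
  assert (Hc0 := check_erasure_lt lam rho p l H).
  assert (Hc1 := check_erasure_lt lam rho p (S l) H).
  assert (Hc2 := check_erasure_lt lam rho p (S (S l)) H).
  assert (Hd0 := message_erasure_decrease lam rho p l H).
  assert (Hd1 := message_erasure_decrease lam rho p (S l) H).
  assert (P0 : 0 < p * lam 2%nat * (check_erasure lam rho p l - check_erasure lam rho p (S l)))
    by (apply Rmult_lt_0_compat; lra).
  assert (P1 : 0 < p * lam 2%nat * (check_erasure lam rho p (S l) - check_erasure lam rho p (S (S l))))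
    by (apply Rmult_lt_0_compat; lra).
  assert (Hs : 0 < s) by (unfold s; apply Rdiv_lt_0_compat; lra).
  assert (Hch := fun t => rho_above_chord lam rho p (S l) t H). fold s in Hch.
  assert (Ey : edge_gf rho (1 - message_erasure lam rho p l) = 1 - check_erasure lam rho p (S l)) by (simpl; ring).
  assert (Ex := message_erasure_check lam rho p (S l) Hl).
  unfold staircase_area.
  set (x := message_erasure lam rho p l) in *. set (x1 := message_erasure lam rho p (S l)) in *.
  set (y := check_erasure lam rho p (S l)) in *. set (y1 := check_erasure lam rho p (S (S l))) in *.
  clearbody s x x1 y y1.
  rewrite (RInt_edge_gf_Chasles 1 rho 0 (1 - x) (1 - x1)), (RInt_edge_gf_Chasles 2 lam y1 y 1) by (auto; lra).
  (* [d / s] is the base of the right triangle; the chord bound at [1 - x] shows that it fits. *)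
  assert (Ir : (1 - y) * ((1 - x1) - (1 - x)) + d * (d / s) - s * (d / s) ^ 2 / 2
     <= RInt (edge_gf rho) (1 - x) (1 - x1)).
  { assert (Hds : d / s * s = d) by (field; lra).
    apply RInt_ge_corner.
    - split; [apply Rlt_le, Rdiv_lt_0_compat; unfold d; lra|].
      apply Rmult_le_reg_r with s; [lra|]. rewrite Hds.
      specialize (Hch (1 - x) ltac:(lra)). unfold d. lra.
    - apply (ex_RInt_edge_gf 1); auto; lra.
    - intros t Ht. rewrite <- Ey. apply (edge_gf_le 1); auto; lra.
    - intros t Ht. specialize (Hch t ltac:(lra)). unfold d. lra. }
  assert (Il : RInt (edge_gf lam) y1 y <= (edge_gf lam y - lam 2%nat * y) * (y - y1)
     + lam 2%nat * (y ^ 2 - y1 ^ 2) / 2 + 0 * (y ^ 3 - y1 ^ 3) / 3).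
  { apply RInt_le_quadratic; [lra|apply (ex_RInt_edge_gf 2); auto; lra|].
    intros t Ht. assert (Hb := edge_gf_increment 2 lam t y ltac:(lia) Hl ltac:(lra) ltac:(lra)). lra. }
  apply (Rmult_le_compat_l p) in Il; [|lra].
  replace (d * (d / s) - s * (d / s) ^ 2 / 2) with (d ^ 2 / (2 * s)) in Ir by (field; lra).
  assert (Ix : x1 * (y - y1) = p * edge_gf lam y * (y - y1)) by (rewrite Ex; ring).
  assert (Id : d = y - y1) by reflexivity. clearbody d.
  replace (d ^ 2 / (2 * s)) with (d * (d / s) - s * (d / s) ^ 2 / 2) in * by (field; lra).
  rewrite Id at 1. lra.
Qed.

(** To the left of [p] the quadratic bound on [lam] is integrated. To the right there is only room
    for a width [w <= 1 - p], which may be less than [d / s]. *)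
Lemma staircase_area_0 lam rho p s w : decoding lam rho p ->
  let d := check_erasure lam rho p 0 - check_erasure lam rho p 1 in
  (check_erasure lam rho p 1 - check_erasure lam rho p 2)
    / (message_erasure lam rho p 0 - message_erasure lam rho p 1) <= s ->
  0 <= w <= 1 - p ->
  p * (lam 2%nat * d ^ 2 / 2 + (1 - lam 2%nat) * (d ^ 2 - d ^ 3 / 3)) + w * d - s * w ^ 2 / 2
  <= staircase_area lam rho p 0.
Proof.
  intros H d Hs Hw. assert (Hp := dec_p _ _ _ H). assert (Hl := dec_lam _ _ _ H).
  assert (Hr := dec_rho _ _ _ H).
  assert (H1 := erasures_pos lam rho p 1 H).
  assert (Hch := fun t => rho_above_chord lam rho p 0 t H).
  set (s0 := (check_erasure lam rho p 1 - check_erasure lam rho p 2)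
    / (message_erasure lam rho p 0 - message_erasure lam rho p 1)) in *. clearbody s0.
  unfold staircase_area. change (message_erasure lam rho p 0) with p in *.
  unfold d. clear d. change (check_erasure lam rho p 0) with 1.
  set (y := check_erasure lam rho p 1) in *. clearbody y.
  assert (Ir : 0 * ((1 - p) - 0) + (1 - y) * w - s * w ^ 2 / 2 <= RInt (edge_gf rho) 0 (1 - p)).
  { apply RInt_ge_corner; [lra|apply (ex_RInt_edge_gf 1); auto; lra| |].
    - intros t Ht. apply (edge_gf_bound 1); auto; lra.
    - intros t Ht. specialize (Hch t ltac:(lra)).
      assert (s0 * (1 - p - t) <= s * (1 - p - t)) by (apply Rmult_le_compat_r; lra). lra. }
  assert (Il : RInt (edge_gf lam) y 1 <= 0 * (1 - y)
     + lam 2%nat * (1 ^ 2 - y ^ 2) / 2 + (1 - lam 2%nat) * (1 ^ 3 - y ^ 3) / 3).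
  { apply RInt_le_quadratic; [lra|apply (ex_RInt_edge_gf 2); auto; lra|].
    intros t Ht. assert (Hb := edge_gf_le_quadratic lam t Hl ltac:(lra)). lra. }
  apply (Rmult_le_compat_l p) in Il; [|lra]. lra.
Qed.

(** The inverse slope [e / d'] of the chord is at least [q] by concavity, and at least [q * d / d']
    because [e >= q * d]. *)
Lemma staircase_area_step_ge lam rho p l : decoding lam rho p ->
  let d := check_erasure lam rho p (S l) - check_erasure lam rho p (S (S l)) in
  let d' := check_erasure lam rho p (S (S l)) - check_erasure lam rho p (S (S (S l))) in
  p * lam 2%nat * d ^ 2 <= staircase_area lam rho p (S l) - staircase_area lam rho p l /\
  p * lam 2%nat * (d ^ 2 * (1 + d / d') / 2)
    <= staircase_area lam rho p (S l) - staircase_area lam rho p l.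
Proof.
  intros H d d'. assert (Hst := staircase_area_step lam rho p l H). fold d d' in Hst. cbv zeta in Hst.
  assert (Hq : 0 < p * lam 2%nat) by (apply Rmult_lt_0_compat; apply H).
  assert (Hd : 0 < d) by (assert (Hc := check_erasure_lt lam rho p (S l) H); unfold d; lra).
  assert (Hd' : 0 < d') by (assert (Hc := check_erasure_lt lam rho p (S (S l)) H); unfold d'; lra).
  assert (H1 := chord_slope_le lam rho p (S l) H). fold d' in H1.
  assert (H2 := message_erasure_decrease lam rho p (S l) H). fold d in H2.
  set (e := message_erasure lam rho p (S l) - message_erasure lam rho p (S (S l))) in *.
  assert (He : 0 < e) by (assert (0 < p * lam 2%nat * d) by (apply Rmult_lt_0_compat; lra); lra).
  replace (d ^ 2 / (2 * (d' / e))) with (d ^ 2 / 2 * (e / d')) in Hst by (field; lra).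
  set (q := p * lam 2%nat) in *. clearbody d d' e q.
  assert (Hd2 : 0 <= d ^ 2 / 2) by (assert (0 <= d ^ 2) by apply pow2_ge_0; lra).
  assert (Hinv : 0 < / d') by (apply Rinv_0_lt_compat; lra).
  split; apply Rle_trans with (2 := Hst).
  - assert (q <= e / d').
    { apply Rmult_le_reg_r with d'; [lra|]. unfold Rdiv. rewrite Rmult_assoc, Rinv_l by lra. lra. }
    assert (d ^ 2 / 2 * q <= d ^ 2 / 2 * (e / d')) by (apply Rmult_le_compat_l; lra). lra.
  - assert (q * (d / d') <= e / d').
    { unfold Rdiv. rewrite <- Rmult_assoc. apply Rmult_le_compat_r; lra. }
    assert (d ^ 2 / 2 * (q * (d / d')) <= d ^ 2 / 2 * (e / d')) by (apply Rmult_le_compat_l; lra). lra.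
Qed.

Lemma staircase_area_0_le lam rho p : decoding lam rho p ->
  staircase_area lam rho p 0 <= gap lam rho p.
Proof.
  intros H.
  assert (HN : forall N, staircase_area lam rho p 0 <= staircase_area lam rho p N).
  { induction N as [|N IH]; [lra|].
    destruct (staircase_area_step_ge lam rho p N H) as [Hs _]. cbv zeta in Hs.
    assert (Hq : 0 < p * lam 2%nat) by (apply Rmult_lt_0_compat; apply H).
    set (d := check_erasure lam rho p (S N) - check_erasure lam rho p (S (S N))) in *.
    assert (0 <= p * lam 2%nat * d ^ 2) by (apply Rmult_le_pos; [lra|apply pow2_ge_0]). lra. }
  apply (is_lim_seq_le (fun _ => staircase_area lam rho p 0)
    (fun N => gap lam rho p + p * check_erasure lam rho p (S N))
    (staircase_area lam rho p 0) (gap lam rho p)).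
  - intros N. apply Rle_trans with (1 := HN N). now apply staircase_area_le.
  - apply is_lim_seq_const.
  - replace (Finite (gap lam rho p)) with (Finite (gap lam rho p + p * 0)) by (f_equal; ring).
    apply is_lim_seq_plus'; [apply is_lim_seq_const|].
    apply is_lim_seq_scal_l with (lu := Finite 0). apply -> (is_lim_seq_incr_1 (check_erasure lam rho p)).
    apply H.
Qed.

Lemma RInt_lam_le lam :
  edge_distribution 2 lam -> RInt (edge_gf lam) 0 1 <= 1 / 3 + lam 2%nat / 6.
Proof.
  intros Hl.
  assert (Il : RInt (edge_gf lam) 0 1 <= 0 * (1 - 0)
     + lam 2%nat * (1 ^ 2 - 0 ^ 2) / 2 + (1 - lam 2%nat) * (1 ^ 3 - 0 ^ 3) / 3); [|lra].
  apply RInt_le_quadratic; [lra|apply (ex_RInt_edge_gf 2); auto; lra|].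
  intros t Ht. assert (Hb := edge_gf_le_quadratic lam t Hl ltac:(lra)). lra.
Qed.

(** These alternatives are what [sequence_bound] can absorb. A positive deficit requires the first
    strip to be cut off, and only then are the rate and the stability condition needed. *)
Lemma first_strip_deficit lam rho p : decoding lam rho p ->
  RInt (edge_gf rho) 0 1 < RInt (edge_gf lam) 0 1 ->
  let d0 := check_erasure lam rho p 0 - check_erasure lam rho p 1 in
  let d1 := check_erasure lam rho p 1 - check_erasure lam rho p 2 in
  let D := d0 ^ 2 - staircase_area lam rho p 0 / (p * lam 2%nat) in
  D <= d0 ^ 2 / 2 /\
  (D <= 0 \/ d0 <= d1 \/ D <= d0 * d1 / 2 - (d0 - d1) ^ 2 / 16).
Proof.
  intros H Hrate d0 d1 D.
  assert (Hp := dec_p _ _ _ H). assert (Hl := dec_lam _ _ _ H).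
  assert (Hr := dec_rho _ _ _ H). assert (Hl2 := dec_lam2 _ _ _ H).
  assert (Hl21 := edge_coef_le_1 2 lam 2 Hl).
  assert (Hq : 0 < p * lam 2%nat) by (apply Rmult_lt_0_compat; apply H).
  assert (Hd0 : 0 < d0) by (assert (Hc := check_erasure_lt lam rho p 0 H); unfold d0; lra).
  assert (Hd01 : d0 <= 1).
  { assert (Hc := erasures_pos lam rho p 1 H). unfold d0. change (check_erasure lam rho p 0) with 1. lra. }
  assert (Hd1 : 0 < d1) by (assert (Hc := check_erasure_lt lam rho p 1 H); unfold d1; lra).
  assert (Hx := message_erasure_decrease lam rho p 0 H). fold d0 in Hx.
  assert (Hsl := chord_slope_le lam rho p 0 H). fold d1 in Hsl.
  assert (HA := fun s w => staircase_area_0 lam rho p s w H). cbv zeta in HA.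
  fold d0 d1 in HA.
  set (e := message_erasure lam rho p 0 - message_erasure lam rho p 1) in *.
  assert (He : 0 < e) by (assert (0 < p * lam 2%nat * d0) by (apply Rmult_lt_0_compat; lra); lra).
  assert (Hs : 0 < d1 / e) by (apply Rdiv_lt_0_compat; lra).
  assert (Hsq : p * lam 2%nat * (d1 / e) <= 1).
  { apply Rmult_le_reg_r with e; [lra|].
    replace (p * lam 2%nat * (d1 / e) * e) with (p * lam 2%nat * d1) by (field; lra). lra. }
  assert (Hdd : 0 <= d0 ^ 2 - d0 ^ 3 / 3).
  { assert (0 <= d0 ^ 2 * (1 - d0 / 3)) by (apply Rmult_le_pos; [apply pow2_ge_0|lra]). lra. }
  assert (Hdd' : 0 <= p * ((1 - lam 2%nat) * (d0 ^ 2 - d0 ^ 3 / 3)))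
    by (repeat apply Rmult_le_pos; lra).
  assert (HD : forall c, p * lam 2%nat * (d0 ^ 2 - c) <= staircase_area lam rho p 0 -> D <= c).
  { intros c Hc. unfold D. apply Rmult_le_reg_r with (p * lam 2%nat); [lra|].
    replace ((d0 ^ 2 - staircase_area lam rho p 0 / (p * lam 2%nat)) * (p * lam 2%nat))
      with (d0 ^ 2 * (p * lam 2%nat) - staircase_area lam rho p 0) by (field; lra). lra. }
  split.
  (* Width 0: the part to the left of [p] already covers half of [q * d0 ^ 2]. *)
  { apply HD. specialize (HA (d1 / e) 0 ltac:(lra) ltac:(lra)). lra. }
  (* If [q * d0 <= 1 - p], the whole triangle of slope [1 / q] fits and there is no deficit. *)
  destruct (Rle_dec (p * lam 2%nat * d0) (1 - p)) as [Hsmall|Hbad].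
  { left. apply HD.
    specialize (HA (1 / (p * lam 2%nat)) (p * lam 2%nat * d0)).
    replace (1 / (p * lam 2%nat) * (p * lam 2%nat * d0) ^ 2 / 2) with (p * lam 2%nat * d0 ^ 2 / 2)
      in HA by (field; lra).
    assert (0 <= p * lam 2%nat * d0) by (apply Rmult_le_pos; lra).
    assert (d1 / e <= 1 / (p * lam 2%nat)).
    { apply Rmult_le_reg_l with (p * lam 2%nat); [lra|].
      replace (p * lam 2%nat * (1 / (p * lam 2%nat))) with 1 by (field; lra). lra. }
    specialize (HA ltac:(lra) ltac:(lra)). lra. }
  right. destruct (Rle_dec d0 d1) as [Hle|Hgt]; [now left|right].
  apply HD.
  assert (HM := decoding_moment lam rho p H).
  assert (Hm1 := moment_ge 1 rho _ ltac:(lia) Hr HM).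
  assert (Hm2 := RInt_edge_gf_ge 1 rho _ ltac:(lia) Hr HM).
  assert (HL := RInt_lam_le lam Hl).
  assert (HA0 := staircase_area_0_le lam rho p H).
  assert (Hgap : gap lam rho p <= (1 - p) * RInt (edge_gf lam) 0 1) by (unfold gap; lra).
  assert (HgapL : (1 - p) * RInt (edge_gf lam) 0 1 <= (1 - p) * (1 / 2)) by (apply Rmult_le_compat_l; lra).
  assert (Hr1 : 0 <= rho 1%nat <= 1) by (split; [apply Hr|apply (edge_coef_le_1 1 rho 1 Hr)]).
  assert (Hr2 : rho 2%nat <= d1 / e).
  { assert (Hi := erasures_pos lam rho p 1 H).
    assert (Hc := edge_gf_increment 1 rho (1 - message_erasure lam rho p 0)
      (1 - message_erasure lam rho p 1) ltac:(lia) Hr). change (message_erasure lam rho p 0) with p in Hc.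
    specialize (Hc ltac:(unfold e in He; simpl in He |- *; lra) ltac:(lra)).
    apply Rmult_le_reg_r with e; [lra|]. replace (d1 / e * e) with d1 by (field; lra).
    unfold e, d1. change (check_erasure lam rho p 2) with (1 - edge_gf rho (1 - message_erasure lam rho p 1)).
    change (check_erasure lam rho p 1) with (1 - edge_gf rho (1 - p)).
    change (message_erasure lam rho p 0) with p. lra. }
  assert (Hd0c : d0 <= rho 1%nat + (1 - rho 1%nat) * (1 - p)).
  { assert (Hc := edge_gf_convex 1 rho 0 (1 - p) 1 ltac:(lia) Hr ltac:(lra) ltac:(lra)).
    rewrite (edge_gf_1 1) in Hc by (auto; lia). rewrite edge_gf_0 in Hc.
    unfold d0. simpl. lra. }
  assert (Hfs := first_strip p (lam 2%nat) d0 (rho 1%nat) (rho 2%nat) (d1 / e)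
    (staircase_area lam rho p 0) Hp ltac:(lra) ltac:(lra) Hr1 Hr2 ltac:(lra) Hsq ltac:(lra)
    Hd0c Hm1 ltac:(lra) ltac:(lra)).
  cbv zeta in Hfs. specialize (HA (d1 / e) (1 - p) ltac:(lra) ltac:(lra)).
  specialize (Hfs ltac:(lra)).
  apply Rle_trans with (2 := Hfs). apply Rmult_le_compat_l; [lra|].
  (* [first_strip] gives its bound with [k = 1 - kap]. As [e >= q * d0], [kap] is at most [d1 / d0],
     so [k] may be lowered to [1 - d1 / d0]. *)
  set (kap := p * lam 2%nat * (d1 / e)) in *.
  assert (Hk : 0 <= kap) by (unfold kap; apply Rmult_le_pos; lra).
  set (X := d1 / d0). assert (HX : X * d0 = d1) by (unfold X; field; lra).
  assert (HkX : kap <= X).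
  { apply Rmult_le_reg_r with e; [lra|].
    replace (kap * e) with (p * lam 2%nat * d1) by (unfold kap; field; lra).
    rewrite <- HX.
    apply Rle_trans with (X * (p * lam 2%nat * d0)); [right; ring|].
    apply Rmult_le_compat_l; [unfold X; apply Rlt_le, Rdiv_lt_0_compat; lra|lra]. }
  assert (HX1 : X <= 1) by (apply Rmult_le_reg_r with d0; lra).
  rewrite <- HX.
  replace (d0 ^ 2 - (d0 * (X * d0) / 2 - (d0 - X * d0) ^ 2 / 16))
    with (d0 ^ 2 * (1 / 2 + (1 - X) / 2 + (1 - X) ^ 2 / 16)) by field.
  apply Rmult_le_compat_l; [apply pow2_ge_0|].
  assert (0 <= (X - kap) * (2 - X - kap)) by (apply Rmult_le_pos; lra). lra.
Qed.

Lemma gap_ge lam rho p m : decoding lam rho p ->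
  RInt (edge_gf rho) 0 1 < RInt (edge_gf lam) 0 1 ->
  p * lam 2%nat * (1 - check_erasure lam rho p (S m)) ^ 2 <= INR (S m) * gap lam rho p.
Proof.
  intros H Hrate.
  assert (Hq : 0 < p * lam 2%nat) by (apply Rmult_lt_0_compat; apply H).
  set (q := p * lam 2%nat) in *.
  destruct (first_strip_deficit lam rho p H Hrate) as [HD1 HD2]. fold q in HD1, HD2.
  assert (Hdiv : forall u v, q * u <= v -> u <= v / q).
  { intros u v Huv. apply Rmult_le_reg_l with q; [lra|].
    replace (q * (v / q)) with v by (field; lra). exact Huv. }
  cbv zeta in HD1, HD2.
  assert (Hfin : (1 - check_erasure lam rho p (S m)) ^ 2 <= INR (S m) * (gap lam rho p / q)).
  { apply (sequence_bound (check_erasure lam rho p) (fun N => staircase_area lam rho p N / q)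
      (gap lam rho p / q) (p / q)
      ((check_erasure lam rho p 0 - check_erasure lam rho p 1) ^ 2 - staircase_area lam rho p 0 / q)).
    - reflexivity.
    - apply H.
    - intros l. assert (Hc := check_erasure_lt lam rho p l H). lra.
    - intros N. replace (gap lam rho p / q + p / q * check_erasure lam rho p (S N))
        with ((gap lam rho p + p * check_erasure lam rho p (S N)) / q) by (field; lra).
      unfold Rdiv. apply Rmult_le_compat_r; [apply Rlt_le, Rinv_0_lt_compat; lra|].
      now apply staircase_area_le.
    - right. ring.
    - exact HD1.
    - exact HD2.
    - intros l. unfold Rdiv. rewrite <- Rmult_minus_distr_r. apply Hdiv. apply staircase_area_step_ge, H.
    - intros l. unfold Rdiv. rewrite <- Rmult_minus_distr_r. apply Hdiv. apply staircase_area_step_ge, H. }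
  apply (Rmult_le_compat_l q) in Hfin; [|lra].
  replace (q * (INR (S m) * (gap lam rho p / q))) with (INR (S m) * gap lam rho p) in Hfin by (field; lra).
  exact Hfin.
Qed.

(** * From bit erasures to the number of iterations *)

Lemma RInt_lam_ge lam :
  edge_distribution 2 lam -> lam 2%nat / 2 <= RInt (edge_gf lam) 0 1.
Proof.
  intros Hl.
  assert (Il : 0 * (1 - 0) + lam 2%nat * (1 ^ 2 - 0 ^ 2) / 2 <= RInt (edge_gf lam) 0 1); [|lra].
  apply RInt_ge_linear; [lra|apply (ex_RInt_edge_gf 2); auto; lra|].
  intros t Ht. assert (Hb := lam2_mul_le lam t Hl ltac:(lra)). lra.
Qed.

Lemma node_gf_ge lam y :
  edge_distribution 2 lam -> 0 < lam 2%nat -> 0 <= y <= 1 ->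
  node_fraction lam 2 * y ^ 2 <= node_gf lam y.
Proof.
  intros Hl Hl2 Hy.
  apply (is_series_ge_term (fun i => node_fraction lam i * y ^ i) _ 2 (node_gf_coef lam y Hl Hy)).
  intros k _. apply Rmult_le_pos; [|apply pow_le; lra].
  assert (HL := RInt_lam_ge lam Hl). unfold node_fraction, Rdiv.
  apply Rmult_le_pos; [|apply Rlt_le, Rinv_0_lt_compat; lra].
  destruct k as [|k]; [destruct Hl as (_ & H0 & _); rewrite (H0 0%nat) by lia; lra|].
  apply Rmult_le_pos; [apply Hl|apply Rlt_le, Rinv_0_lt_compat, lt_0_INR; lia].
Qed.

Lemma check_erasure_bound lam rho p l :
  0 < p < 1 -> edge_distribution 2 lam -> edge_distribution 1 rho ->
  0 <= check_erasure lam rho p l <= 1.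
Proof.
  intros Hp Hl Hr.
  assert (Hx : forall l, 0 <= check_erasure lam rho p l <= 1 -> 0 <= message_erasure lam rho p l <= 1).
  { intros l' Hy. rewrite message_erasure_check by auto.
    assert (H2 := edge_gf_bound 2 lam (check_erasure lam rho p l') ltac:(lia) Hl Hy).
    split; [apply Rmult_le_pos|]; nra. }
  induction l as [|l IH]; [simpl; lra|]. apply Hx in IH. simpl.
  assert (H1 := edge_gf_bound 1 rho (1 - message_erasure lam rho p l) ltac:(lia) Hr ltac:(lra)). lra.
Qed.

Lemma bit_erasure_ge lam rho p l :
  0 < p < 1 -> edge_distribution 2 lam -> edge_distribution 1 rho -> 0 < lam 2%nat ->
  p * node_fraction lam 2 * check_erasure lam rho p (S l) ^ 2 <= bit_erasure lam rho p l.
Proof.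
  intros Hp Hl Hr Hl2. rewrite Rmult_assoc. apply Rmult_le_compat_l; [lra|].
  apply node_gf_ge; auto. now apply (check_erasure_bound lam rho p (S l)).
Qed.

(** The bit erasure probability dominates [p * L_2 * y ^ 2], so a square root squeezes [y] to 0. And
    [rho_1 <= int rho < int lam <= 1/2]. *)
Lemma bit_erasure_decoding lam rho p :
  0 < p < 1 -> edge_distribution 2 lam -> edge_distribution 1 rho -> 0 < lam 2%nat ->
  RInt (edge_gf rho) 0 1 < RInt (edge_gf lam) 0 1 ->
  is_lim_seq (bit_erasure lam rho p) 0 -> decoding lam rho p.
Proof.
  intros Hp Hl Hr Hl2 Hrate Hlim.
  assert (HL := RInt_lam_le lam Hl). assert (HL2 := RInt_lam_ge lam Hl).
  assert (Hl21 := edge_coef_le_1 2 lam 2 Hl).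
  assert (Hf : 0 < p * node_fraction lam 2).
  { apply Rmult_lt_0_compat; [lra|]. unfold node_fraction.
    apply Rdiv_lt_0_compat; [|lra]. apply Rdiv_lt_0_compat; simpl; lra. }
  split; auto.
  - assert (Ir : rho 1%nat * (1 - 0) + 0 * (1 ^ 2 - 0 ^ 2) / 2 <= RInt (edge_gf rho) 0 1); [|lra].
    apply RInt_ge_linear; [lra|apply (ex_RInt_edge_gf 1); auto; lra|].
    intros t Ht. rewrite <- edge_gf_0.
    assert (Hm := edge_gf_le 1 rho 0 t ltac:(lia) Hr ltac:(lra) ltac:(lra)). lra.
  - apply is_lim_seq_incr_1.
    set (f := p * node_fraction lam 2) in *.
    apply (is_lim_seq_le_le (fun _ => 0) _ (fun l => sqrt (bit_erasure lam rho p l / f))).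
    + intros l. assert (Hc := check_erasure_bound lam rho p (S l) Hp Hl Hr). split; [lra|].
      rewrite <- (sqrt_pow2 (check_erasure lam rho p (S l))) by lra. apply sqrt_le_1_alt.
      apply Rmult_le_reg_l with f; [lra|].
      replace (f * (bit_erasure lam rho p l / f)) with (bit_erasure lam rho p l) by (field; lra).
      now apply bit_erasure_ge.
    + apply is_lim_seq_const.
    + rewrite <- sqrt_0. apply is_lim_seq_continuous; [apply continuity_pt_sqrt; lra|].
      replace (Finite 0) with (Finite (0 * / f)) by (f_equal; ring).
      apply is_lim_seq_scal_r with (lu := Finite 0). exact Hlim.
Qed.

Theorem theorem1 :
  forall (p eps : R) (n : nat -> nat) (lam rho : nat -> R) (Pb : R),
    0 < p < 1 ->
    0 < eps < 1 ->
    edge_distribution 2 lam ->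
    edge_distribution 1 rho ->
    is_lim_seq (fun m => INR (n m)) p_infty ->
    achieves_capacity_fraction lam rho p (1 - eps) ->
    0 <= Pb ->
    Pb < p * node_fraction lam 2 ->
    Rbar_le
      (Finite (2 / (1 - p)
               * (sqrt (p * node_fraction lam 2) - sqrt Pb) ^ 2
               * (1 / eps)))
      (num_iterations lam rho p Pb).
Proof.
  intros p eps n lam rho Pb Hp Heps Hl Hr _ [HR Hlim] HPb HPb2.
  (* Otherwise [p * L_2 = 0], contradicting [0 <= Pb < p * L_2]. *)
  assert (Hl2 : 0 < lam 2%nat).
  { destruct (proj1 Hl 2%nat) as [Hlt|Heq]; [exact Hlt|].
    unfold node_fraction, Rdiv in HPb2. rewrite <- Heq in HPb2. lra. }
  assert (HL := RInt_lam_ge lam Hl).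
  assert (Hgap : gap lam rho p <= eps * ((1 - p) * RInt (edge_gf lam) 0 1)).
  { unfold design_rate in HR. apply (Rmult_le_compat_r (RInt (edge_gf lam) 0 1)) in HR; [|lra].
    replace ((1 - RInt (edge_gf rho) 0 1 / RInt (edge_gf lam) 0 1) * RInt (edge_gf lam) 0 1)
      with (RInt (edge_gf lam) 0 1 - RInt (edge_gf rho) 0 1) in HR by (field; lra).
    unfold gap. lra. }
  assert (HpL : 0 < (1 - p) * RInt (edge_gf lam) 0 1) by (apply Rmult_lt_0_compat; lra).
  assert (Hrate : RInt (edge_gf rho) 0 1 < RInt (edge_gf lam) 0 1).
  { assert (eps * ((1 - p) * RInt (edge_gf lam) 0 1) < 1 * ((1 - p) * RInt (edge_gf lam) 0 1))
      by (apply Rmult_lt_compat_r; lra).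
    unfold gap in Hgap. lra. }
  assert (Hdec := bit_erasure_decoding lam rho p Hp Hl Hr Hl2 Hrate Hlim).
  unfold num_iterations, least_nat.
  (* An infinite count is trivial. Otherwise [S m] iterations end with index [m], whose check
     message erasure is [check_erasure (S m)]. *)
  destruct (LPO_min _ _) as [[m [[Hm1 HmP] Hmin]]|]; [|exact I].
  cbn [proj1_sig]. destruct m as [|m]; [lia|].
  replace (S m - 1)%nat with m in HmP by lia.
  assert (Hge := gap_ge lam rho p m Hdec Hrate).
  assert (Hb := bit_erasure_ge lam rho p m Hp Hl Hr Hl2).
  assert (Hy := check_erasure_bound lam rho p (S m) Hp Hl Hr).
  set (y := check_erasure lam rho p (S m)) in *. clearbody y.
  set (f := p * node_fraction lam 2) in *.
  (* [L_2 = lam_2 / (2 * int lam)] is the source of the factor 2 in the bound. *)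
  assert (Hf : 2 * RInt (edge_gf lam) 0 1 * f = p * lam 2%nat)
    by (unfold f, node_fraction; simpl; field; lra).
  assert (Hsq : sqrt f * y <= sqrt Pb).
  { rewrite <- (sqrt_pow2 y) by lra. rewrite <- sqrt_mult by (try apply pow2_ge_0; lra).
    apply sqrt_le_1_alt. lra. }
  assert (Hsq2 : (sqrt f - sqrt Pb) ^ 2 <= f * (1 - y) ^ 2).
  { replace (f * (1 - y) ^ 2) with ((sqrt f * (1 - y)) ^ 2).
    - apply pow_incr. split; [|lra]. assert (sqrt Pb <= sqrt f) by (apply sqrt_le_1_alt; lra). lra.
    - rewrite Rpow_mult_distr, pow2_sqrt by lra. reflexivity. }
  change (2 / (1 - p) * (sqrt f - sqrt Pb) ^ 2 * (1 / eps) <= INR (S m)).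
  (* The multiplier is the upper bound on the gap, so that [gap_ge] and [Hgap] chain. *)
  apply Rmult_le_reg_r with (eps * ((1 - p) * RInt (edge_gf lam) 0 1)).
  { apply Rmult_lt_0_compat; lra. }
  apply Rle_trans with (INR (S m) * gap lam rho p).
  - apply Rle_trans with (2 := Hge). rewrite <- Hf.
    replace (2 / (1 - p) * (sqrt f - sqrt Pb) ^ 2 * (1 / eps) *
      (eps * ((1 - p) * RInt (edge_gf lam) 0 1)))
      with (2 * RInt (edge_gf lam) 0 1 * (sqrt f - sqrt Pb) ^ 2) by (field; lra).
    rewrite (Rmult_assoc (2 * RInt (edge_gf lam) 0 1) f). apply Rmult_le_compat_l; lra.
  - apply Rmult_le_compat_l; [apply pos_INR|exact Hgap].
Qed.
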